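(* Let $T$ be a nonnegative tensor of order $m$ and dimension $n$, and let $E$ be the identity tensor. (a) If $T$ is weakly irreducible, then $T+E$ is weakly primitive, and hence the higher order power method applied to $T+E$ converges to the unique positive eigenpair $(\rho(T+E),x)$ of $T+E$. Moreover, $(\rho(T+E)-1,x)$ is the unique positive eigenpair of $T$. (b) If $T$ is not weakly irreducible, let $\{I_1,\ldots,I_k\}$, $k>1$, be a partition of $\{1,\ldots,n\}$ obtained by the recursive block-triangularization procedure described in the context, so that every $T_{I_j}$ is weakly irreducible. For each $j\in\{1,\ldots,k\}$, let $(\rho(T_{I_j}),x^{j})$ be the unique positive eigenpair of $T_{I_j}$ if $|I_j|\ge 2$ (which exists and can be obtained by (a) applied to $T_{I_j}$), and the eigenpair $(T_{I_j},1)$ if $|I_j|=1$. Then $\rho(T)=\max_{j=1,\ldots,k}\rho(T_{I_j})$. If $T$ is furthermore symmetric, then for $j^*\in\operatorname{argmax}_{j=1,\ldots,k}\rho(T_{I_j})$, the vector $x\in\mathbb{R}^n$ with $x(I_{j^*})=x^{j^*}$ and $x_i=0$ for $i\notin I_{j^*}$ is a nonnegative eigenvector of $T$.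
   Context: Throughout $m,n\ge 2$ (induced tensors may have dimension one). A tensor $T$ of order $m$ and dimension $n$ is a real array $(T_{i_1\ldots i_m})$, $i_1,\dots,i_m\in\{1,\ldots,n\}$; nonnegative means all entries are nonnegative; symmetric means entries are invariant under all permutations of the indices. $(Tx^{m-1})_i=\sum_{i_2,\ldots,i_m=1}^n T_{ii_2\ldots i_m}x_{i_2}\cdots x_{i_m}$; $x^{[p]}$ is the vector with components $x_i^p$. $(\lambda,x)$, $\lambda\in\mathbb{C}$, $x\in\mathbb{C}^n\setminus\{0\}$, is an eigenpair if $Tx^{m-1}=\lambda x^{[m-1]}$; it is positive if $\lambda>0$ and all components of $x$ are positive. Uniqueness of positive eigenpairs is understood with eigenvectors normalized by $\sum_i x_i=1$ (i.e. up to scaling). $\rho(T)$ is the maximum of $|\lambda|$ over all eigenvalues. $E$ has diagonal elements ($i_1=\cdots=i_m$) equal to $1$ and all others $0$. For nonempty $I\subseteq\{1,\ldots,n\}$, $T_I=(T_{i_1\ldots i_m})_{i_1,\ldots,i_m\in I}$ is the induced tensor, $A_I$ is the principal submatrix of a matrix $A$ indexed by $I$, and $x(I)$ is the vector obtained from $x$ by deleting the $x_j$ with $j\notin I$. A one-dimensional tensor is identified with its entry. The representation $G(T)$ is the matrix whose $(i,j)$ entry is the sum of all $T_{ii_2\ldots i_m}$ over $(i_2,\ldots,i_m)$ with $j\in\{i_2,\ldots,i_m\}$. $T$ is weakly irreducible if $G(T)$ is an irreducible matrix, weakly reducible otherwise, and weakly primitive if $G(T)$ is a primitive matrix (some power is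 entrywise positive). One-dimensional tensors and $1\times 1$ matrices (possibly zero) are by convention (weakly) irreducible. Higher order power method for a nonnegative tensor $S$: from any $x^{(0)}\in\mathbb{R}^n$ with positive components, for $k=0,1,\ldots$ set $\bar x^{(k+1)}=S(x^{(k)})^{m-1}$, $x^{(k+1)}=\dfrac{(\bar x^{(k+1)})^{[1/(m-1)]}}{e^T(\bar x^{(k+1)})^{[1/(m-1)]}}$ ($e$ the all-ones vector), $\alpha(x^{(k+1)})=\max_i\dfrac{(S(x^{(k)})^{m-1})_i}{(x_i^{(k)})^{m-1}}$, $\beta(x^{(k+1)})=\min_i\dfrac{(S(x^{(k)})^{m-1})_i}{(x_i^{(k)})^{m-1}}$; the algorithm stops if $\alpha(x^{(k+1)})=\beta(x^{(k+1)})$. Convergence to the eigenpair $(\lambda,x)$ (with $\sum_i x_i=1$) means $x^{(k)}\to x$, and $\alpha(x^{(k)}),\beta(x^{(k)})\to\lambda$, for the sequences given by the recursion. Partition procedure: For a weakly reducible nonnegative tensor $S$ with index set $J$, choose a partition $\{J_1,\ldots,J_l\}$ of $J$ such that each $[G(S)]_{J_i}$ is irreducible and $[G(S)]_{st}=0$ whenever $s\in J_p$, $t\in J_q$, $p>q$. Start with $S=T$. Keep each $J_i$ for which $S_{J_i}$ is weakly irreducible; for each other $J_i$, apply the same step to $S_{J_i}$ (using its own representation $G(S_{J_i})$), and continue recursively until all induced tensors are weakly irreducible. The sets kept form the partition $\{I_1,\ldots,I_k\}$. *)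

(* Defs.v *)
From mathcomp Require Import all_boot all_order all_algebra.
From mathcomp Require Import all_classical all_reals all_analysis.
From mathcomp Require Export complex.

Set Implicit Arguments.
Unset Strict Implicit.
Unset Printing Implicit Defensive.

Import Order.TTheory GRing.Theory Num.Theory.
Import numFieldNormedType.Exports.

Local Open Scope ring_scope.

(* Order d, dimension n; indices run over 'I_n instead of {1, ..., n}.
   Addition of tensors is the pointwise addition of {ffun _ -> _}. *)
Definition tensor (K : Type) (d n : nat) := {ffun d.-tuple 'I_n -> K}.

Definition nonneg_tensor (R : numDomainType) d n (T : tensor R d n) : Prop :=
  forall s, 0 <= T s.

Definition symmetric_tensor (K : Type) d n (T : tensor K d n) : Prop :=
  forall s t : d.-tuple 'I_n, perm_eq s t -> T s = T t.

Definition identity_tensor (R : pzRingType) d n : tensor R d n :=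
  [ffun s : d.-tuple 'I_n => (constant s)%:R].

(* T_I, of dimension #|I|: enum_val is the increasing enumeration of I. *)
Definition induced_tensor (K : Type) d n (T : tensor K d n) (I : {set 'I_n}) :
    tensor K d #|I| :=
  [ffun s : d.-tuple 'I_#|I| => T (map_tuple (enum_val (A := mem I)) s)].

Definition principal_submx (K : Type) n (A : 'M[K]_n) (I : {set 'I_n}) :
    'M[K]_#|I| :=
  mxsub (enum_val (A := mem I)) (enum_val (A := mem I)) A.

Definition subvector (K : Type) n (x : 'rV[K]_n) (I : {set 'I_n}) :
    'rV[K]_#|I| :=
  colsub (enum_val (A := mem I)) x.

(* Below, tensors have order m.+1, so that the exponent "order minus one" of
   the mathematical notation is m. *)

(* The i-th component of T x^m. *)
Definition tensor_app (K : comPzRingType) m n (T : tensor K m.+1 n)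
    (x : 'rV[K]_n) (i : 'I_n) : K :=
  \sum_(s : m.-tuple 'I_n) T [tuple of i :: s] * \prod_(j <- s) x 0 j.

Definition tensor_representation (R : pzRingType) m n (T : tensor R m.+1 n) : 'M[R]_n :=
  \matrix_(i, j) \sum_(s : m.-tuple 'I_n | j \in val s) T [tuple of i :: s].

(* A matrix of size 1 has no nonempty proper index set, hence is irreducible. *)
Definition reducible_mx (K : pzRingType) n (A : 'M[K]_n) : Prop :=
  exists I : {set 'I_n}, [/\ I != finset.set0, I != finset.setT &
    forall i j, i \in I -> j \notin I -> A i j = 0].

Definition irreducible_mx (K : pzRingType) n (A : 'M[K]_n) : Prop :=
  ~ reducible_mx A.

Definition primitive_mx (R : numDomainType) n (A : 'M[R]_n) : Prop :=
  exists2 k : nat, (0 < k)%N & forall i j, 0 < (A ^+ k) i j.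

Definition weakly_irreducible (R : pzRingType) m n (T : tensor R m.+1 n) : Prop :=
  irreducible_mx (tensor_representation T).

Definition weakly_primitive (R : numDomainType) m n (T : tensor R m.+1 n) : Prop :=
  primitive_mx (tensor_representation T).

Definition complexify_tensor (R : rcfType) d n (T : tensor R d n) :
    tensor R[i] d n :=
  [ffun s => (T s)%:C%C].

Definition complexify_vector (R : rcfType) n (x : 'rV[R]_n) : 'rV[R[i]]_n :=
  map_mx (real_complex R) x.

Definition eigenpair (R : rcfType) m n (T : tensor R m.+1 n)
    (lam : R[i]) (x : 'rV[R[i]]_n) : Prop :=
  x != 0 /\ forall i, tensor_app (complexify_tensor T) x i = lam * x 0 i ^+ m.

Definition tensor_eigenvalue (R : rcfType) m n (T : tensor R m.+1 n) (lam : R[i]) : Prop :=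
  exists x, eigenpair T lam x.

Definition tensor_eigenvector (R : rcfType) m n (T : tensor R m.+1 n)
    (x : 'rV[R[i]]_n) : Prop :=
  exists lam, eigenpair T lam x.

(* In the order of R[i], 0 < z means that z is real and positive. *)
Definition positive_eigenpair (R : rcfType) m n (T : tensor R m.+1 n)
    (lam : R[i]) (x : 'rV[R[i]]_n) : Prop :=
  [/\ eigenpair T lam x, 0 < lam & forall i, 0 < x 0 i].

Definition unique_positive_eigenpair (R : rcfType) m n (T : tensor R m.+1 n)
    (lam : R[i]) (x : 'rV[R[i]]_n) : Prop :=
  [/\ positive_eigenpair T lam x, \sum_i x 0 i = 1 &
    forall mu y, positive_eigenpair T mu y -> \sum_i y 0 i = 1 ->
      mu = lam /\ y = x].

Definition eigenvalue_moduli (R : rcfType) m n (T : tensor R m.+1 n) : set R :=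
  [set Normc.normc lam | lam in tensor_eigenvalue T]%classic.

Definition is_maximum (R : realType) (A : set R) (r : R) : Prop :=
  A r /\ forall y, A y -> y <= r.

(* The supremum is the maximum whenever the latter exists. *)
Definition spectral_radius (R : realType) m n (T : tensor R m.+1 n) : R :=
  sup (eigenvalue_moduli T).

Definition power_step (R : realType) m n (S : tensor R m.+1 n)
    (x : 'rV[R]_n) : 'rV[R]_n :=
  let y := \row_i (tensor_app S x i `^ (m%:R)^-1) in
  (\sum_i y 0 i)^-1 *: y.

Definition power_iterate (R : realType) m n (S : tensor R m.+1 n)
    (x0 : 'rV[R]_n) (k : nat) : 'rV[R]_n :=
  iter k (power_step S) x0.

Definition power_ratio (R : realType) m n (S : tensor R m.+1 n)
    (x : 'rV[R]_n) (i : 'I_n) : R :=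
  tensor_app S x i / x 0 i ^+ m.

(* power_upper S x and power_lower S x, taken at x = x^(k), are
   alpha(x^(k+1)) and beta(x^(k+1)).  The starting values of the two iterated
   operations do not matter: the ratios of a nonnegative tensor at a positive
   vector are nonnegative, and their maximum is not below their minimum. *)
Definition power_upper (R : realType) m n (S : tensor R m.+1 n)
    (x : 'rV[R]_n) : R :=
  \big[Num.max/0]_(i < n) power_ratio S x i.

Definition power_lower (R : realType) m n (S : tensor R m.+1 n)
    (x : 'rV[R]_n) : R :=
  \big[Num.min/power_upper S x]_(i < n) power_ratio S x i.

Definition power_method_converges (R : realType) m n (S : tensor R m.+1 n)
    (lam : R) (x : 'rV[R]_n) : Prop :=
  forall x0 : 'rV[R]_n, (forall i, 0 < x0 0 i) ->
    [/\ (power_iterate S x0 k @[k --> \oo] --> x)%classic,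
        (power_upper S (power_iterate S x0 k) @[k --> \oo] --> lam)%classic &
        (power_lower S (power_iterate S x0 k) @[k --> \oo] --> lam)%classic].

Definition block_triangular (R : pzRingType) n (A : 'M[R]_n)
    (J : seq {set 'I_n}) : Prop :=
  [/\ uniq J,
      finset.partition [set B in J] [set: 'I_n],
      forall B, B \in J -> irreducible_mx (principal_submx A B) &
      forall p q s t, (q < p < size J)%N ->
        s \in nth finset.set0 J p -> t \in nth finset.set0 J q -> A s t = 0].

(* wi_partition T P: the recursive partition procedure applied to T may return
   P.  The sets returned for T_J are subsets of 'I_#|J|; they are sent back to subsets of 'I_n by the enumeration of J. *)
Inductive wi_partition (R : pzRingType) (m : nat) :
    forall n, tensor R m.+1 n -> {set {set 'I_n}} -> Prop :=
| wi_partition_keep n (T : tensor R m.+1 n) :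
    weakly_irreducible T -> wi_partition T [set [set: 'I_n]]
| wi_partition_split n (T : tensor R m.+1 n) (J : seq {set 'I_n})
    (Q : forall B : {set 'I_n}, {set {set 'I_#|B|}}) :
    ~ weakly_irreducible T ->
    block_triangular (tensor_representation T) J ->
    (forall B, B \in J -> wi_partition (induced_tensor T B) (Q B)) ->
    wi_partition T
      (\bigcup_(B <- J) [set (enum_val (A := mem B)) @: C | C : {set 'I_#|B|} in Q B]).

(* The eigenpair attached to a weakly irreducible block S, which in dimension
   one is (S, 1), where S is identified with its single entry. *)
Definition block_eigenpair (R : rcfType) m n (S : tensor R m.+1 n)
    (lam : R) (x : 'rV[R]_n) : Prop :=
  if n == 1%N then
    [/\ forall s, S s = lam, x = const_mx 1 &
        eigenpair S lam%:C%C (complexify_vector x)]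
  else unique_positive_eigenpair S lam%:C%C (complexify_vector x).

(* Main.v *)
Require Import Defs.
From mathcomp Require Import all_boot all_order all_algebra.
From mathcomp Require Import all_classical all_reals all_analysis.
From mathcomp Require Import lra.

Import Order.TTheory GRing.Theory Num.Theory.
Import numFieldNormedType.Exports.
Local Open Scope ring_scope.

Set Implicit Arguments.
Unset Strict Implicit.
Unset Printing Implicit Defensive.

(** Write T x for the vector tensor_app T x, homogeneous of degree m in x, and
    G for the representation of T.  Everything rests on monotonicity: for a
    nonnegative T, 0 <= x <= y implies T x <= T y, and a strict inequality at
    the coordinate j becomes strict at every coordinate i with G i j <> 0.

    A positive eigenvector x, T x = lam x^m, can be scaled until it dominates a
    given y >= 0 with equality at one coordinate.  Evaluating T there shows that
    T y >= mu y^m forces mu <= lam (collatz_wielandt_le).  As the moduli of a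
    complex eigenpair satisfy such an inequality, lam is the spectral radius;
    and under weak irreducibility the coordinates of equality spread to the
    whole index set, so that x is unique up to scaling.

    Existence needs no fixed point theorem: the power method for S = T + E
    produces the eigenvector.  The upper ratios along the iteration decrease to
    some A.  A bound S x <= A x^m propagates along the edges of G to an upper
    bound of every quotient x_j / x_i (apriori_lower_bound), so the normalized
    iterates stay in a compact box of positive vectors.  At a cluster point z,
    continuity makes the upper ratio equal to A along the whole orbit of z.  If
    S z <> A z^m, then (S z)_i < A z_i^m for some i; the diagonal of S keeps
    such strict coordinates strict, the edges of G add new ones, and after n
    steps all of them are strict, so the upper ratio has dropped below A, a
    contradiction.  Hence all cluster points are positive eigenvectors, hence
    equal by uniqueness, and the iteration converges (shifted_power_method).

    For an arbitrary nonnegative T, the positive eigenpairs of T plus a constant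
    tensor eps have a limit point as eps decreases to 0.  It is a nonnegative
    eigenpair of T whose eigenvalue still bounds every mu with T y >= mu y^m, so
    it is the spectral radius, and a maximum (nonneg_perron).  In a block
    triangular decomposition, an eigenvector of T, restricted to the last block
    on which it does not vanish, is an eigenvector of that block with the same
    eigenvalue (block_triangular_eigenvalue); conversely, a nonnegative
    eigenvector of an induced tensor, extended by zero, satisfies T y >= mu y^m.
    This gives the maximum formula, by induction on the recursive procedure.  If
    T is symmetric, block triangular means block diagonal: no nonzero entry mixes
    indices inside and outside a block (symmetric_blocks_split), and extension by
    zero gives eigenvectors of T. *)

(** * Irreducible matrices *)

Lemma irreducible_exit (K : pzRingType) n (A : 'M[K]_n) (I : {set 'I_n}) :
  irreducible_mx A -> I != finset.set0 -> I != finset.setT ->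
  exists i j, [/\ i \in I, j \notin I & A i j != 0].
Proof.
move=> Airr I0 IT; apply: contrapT => Hn; apply: Airr; exists I; split => //.
move=> i j iI jI; apply/eqP; apply: contrapT => /negP Aij.
by apply: Hn; exists i, j.
Qed.

(** The counting behind primitivity, the a priori bound and the strict decrease
    of the upper ratio: each step adds an index, and there are n of them. *)
Lemma chain_exhausts n (I : nat -> {set 'I_n}) :
  I 0%N != finset.set0 -> (forall k, I k \subset I k.+1) ->
  (forall k, I k != finset.setT -> exists2 j, j \notin I k & j \in I k.+1) ->
  I n = finset.setT.
Proof.
move=> I0 Isub Igrow.
suff H k : (I k == finset.setT) \/ (k < #|I k|)%N.
  have [/eqP //|lt_nI] := H n.
  by have := max_card (mem (I n)); rewrite card_ord leqNgt lt_nI.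
elim: k => [|k [/eqP IkT|IHk]]; first by right; rewrite card_gt0.
  by left; rewrite finset.eqEsubset finset.subsetT -IkT Isub.
have [/eqP IkT|IkT] := boolP (I k == finset.setT).
  by left; rewrite finset.eqEsubset finset.subsetT -IkT Isub.
right; apply: leq_ltn_trans IHk _; apply: proper_card.
rewrite properE Isub /=; apply/subsetPn.
by have [j jk jk1] := Igrow k IkT; exists j.
Qed.

(** The positive diagonal makes the support of a row of A ^+ k increase with k,
    and irreducibility makes it grow strictly until it is full. *)
Lemma nonneg_irreducible_primitive (R : numDomainType) n (A : 'M[R]_n) :
  (0 < n)%N -> (forall i j, 0 <= A i j) -> irreducible_mx A ->
  (forall i, 0 < A i i) -> primitive_mx A.
Proof.
move=> n0 A0 Airr Ad; exists n => // i j.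
have Xge0 k : forall l, 0 <= (A ^+ k) i l.
  elim: k => [|k IHk] l; first by rewrite expr0 mxE ler0n.
  by rewrite exprSr mxE; apply: sumr_ge0 => p _; apply: mulr_ge0.
have step k l p : 0 < (A ^+ k) i l -> A l p != 0 -> 0 < (A ^+ k.+1) i p.
  move=> Akl Alp; rewrite exprSr mxE (bigD1 l) //= ltr_pwDl //.
    by rewrite mulr_gt0 // lt_def Alp A0.
  by apply: sumr_ge0 => q _; apply: mulr_ge0.
pose I k := [set l | 0 < (A ^+ k) i l].
suff /setP /(_ j) : I n = finset.setT by rewrite !inE.
have I0 k : i \in I k.
  rewrite inE; elim: k => [|k IHk]; first by rewrite expr0 mxE eqxx ltr01.
  by apply: step IHk _; rewrite gt_eqF.
apply: chain_exhausts => [|k|k IkT].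
- by apply/set0Pn; exists i.
- by apply/fintype.subsetP => l; rewrite !inE => /step; apply; rewrite gt_eqF.
- have [|l [p [lI pI Alp]]] := irreducible_exit Airr _ IkT.
    by apply/set0Pn; exists i.
  by exists p => //; rewrite inE; apply: step Alp; rewrite inE in lI.
Qed.

(** * The polynomial map of a tensor *)

Section TensorApp.
Variables (R : realType) (m n : nat).
Implicit Types (S T : tensor R m.+1 n) (x y : 'rV[R]_n).

Lemma tensor_representation_neq0 T i j :
  tensor_representation T i j != 0 ->
  exists2 s : m.-tuple 'I_n, j \in val s & T [tuple of i :: s] != 0.
Proof.
move=> Gij; apply: contrapT => Hn; move/eqP: Gij; apply.
rewrite mxE big1 // => s js; apply/eqP; apply: contrapT => /negP Ts.
by apply: Hn; exists s.
Qed.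

Lemma tensor_representation_ge0 T : nonneg_tensor T ->
  forall i j, 0 <= tensor_representation T i j.
Proof. by move=> T0 i j; rewrite mxE sumr_ge0. Qed.

Lemma tensor_representation_gt0 T i j (s : m.-tuple 'I_n) :
  nonneg_tensor T -> j \in val s -> T [tuple of i :: s] != 0 ->
  tensor_representation T i j != 0.
Proof.
move=> T0 js Ts; rewrite mxE gt_eqF // (bigD1 s) //= ltr_pwDl //.
  by rewrite lt_def Ts T0.
by apply: sumr_ge0.
Qed.

Lemma tensor_app_ge0 T x i : nonneg_tensor T -> (forall j, 0 <= x 0 j) ->
  0 <= tensor_app T x i.
Proof.
move=> T0 x0; apply: sumr_ge0 => s _; apply: mulr_ge0 => //.
exact: prodr_ge0.
Qed.

Lemma prod_seq_le (I : Type) (s : seq I) (f g : I -> R) :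
  (forall j, 0 <= f j <= g j) -> \prod_(j <- s) f j <= \prod_(j <- s) g j.
Proof. by move=> fg; apply: ler_prod. Qed.

Lemma ler_tensor_app T x y i : nonneg_tensor T ->
  (forall j, 0 <= x 0 j <= y 0 j) -> tensor_app T x i <= tensor_app T y i.
Proof.
move=> T0 xy; apply: ler_sum => s _; apply: ler_wpM2l => //.
exact: prod_seq_le.
Qed.

(** A nonzero G i j comes from an entry of row i one of whose monomials contains
    x_j; since all coordinates of x are positive, that monomial increases
    strictly. *)
Lemma ltr_tensor_app T x y i j : nonneg_tensor T ->
  (forall j, 0 < x 0 j <= y 0 j) -> x 0 j < y 0 j ->
  tensor_representation T i j != 0 ->
  tensor_app T x i < tensor_app T y i.
Proof.
move=> T0 xy xyj /tensor_representation_neq0[s js Ts].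
have xy' k : 0 <= x 0 k <= y 0 k by have /andP[/ltW-> ->] := xy k.
rewrite /tensor_app (bigD1 s) //= [ltRHS](bigD1 s) //= ltr_leD //; last first.
  by apply: ler_sum => t _; apply: ler_wpM2l => //; apply: prod_seq_le.
have Tgt0 : 0 < T [tuple of i :: s] by rewrite lt_def Ts T0.
rewrite ltr_pM2l // !(big_rem _ js) /=.
apply: (@lt_le_trans _ _ (y 0 j * \prod_(k <- rem j s) x 0 k)).
  by rewrite ltr_pM2r //; apply: prodr_gt0 => k _; have /andP[] := xy k.
apply: ler_wpM2l; last exact: prod_seq_le.
by have /andP[x0 x0y] := xy' j; apply: le_trans x0y.
Qed.

Lemma tensor_appZ T (c : R) x i :
  tensor_app T (c *: x) i = c ^+ m * tensor_app T x i.
Proof.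
rewrite /tensor_app mulr_sumr; apply: eq_bigr => s _.
have -> : \prod_(j <- s) (c *: x) 0 j = c ^+ m * \prod_(j <- s) x 0 j.
  rewrite (eq_bigr (fun j => c * x 0 j)) => [|j _]; last by rewrite mxE.
  by rewrite big_split /= big_const_seq count_predT size_tuple iter_mulr_1.
by rewrite mulrCA.
Qed.

Lemma tensor_appD S T x i :
  tensor_app (S + T) x i = tensor_app S x i + tensor_app T x i.
Proof.
rewrite /tensor_app -big_split /=; apply: eq_bigr => s _.
by rewrite ffunE mulrDl.
Qed.

Lemma constant_consE (i : 'I_n) (s : m.-tuple 'I_n) :
  constant [tuple of i :: s] = (s == nseq_tuple m i).
Proof.
rewrite /=; apply/idP/idP => [/all_pred1P|/eqP->].
  by rewrite size_tuple => si; apply/eqP/val_inj.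
by apply: all_pred1_nseq.
Qed.

Lemma tensor_app_identity x i :
  tensor_app (identity_tensor R m.+1 n) x i = x 0 i ^+ m.
Proof.
rewrite /tensor_app (bigD1 (nseq_tuple m i)) //= [X in _ + X]big1 => [|s si].
  by rewrite addr0 ffunE constant_consE eqxx mul1r big_nseq iter_mulr_1.
by rewrite ffunE constant_consE (negbTE si) mul0r.
Qed.

Lemma identity_tensor_ge0 : nonneg_tensor (identity_tensor R m.+1 n).
Proof. by move=> s; rewrite ffunE ler0n. Qed.

Lemma nonneg_tensorD S T :
  nonneg_tensor S -> nonneg_tensor T -> nonneg_tensor (S + T).
Proof. by move=> S0 T0 s; rewrite ffunE addr_ge0. Qed.

Lemma tensor_representationD S T :
  tensor_representation (S + T) = tensor_representation S + tensor_representation T.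
Proof.
apply/matrixP => i j; rewrite !mxE -big_split /=.
by apply: eq_bigr => s _; rewrite ffunE.
Qed.

Lemma tensor_representation_identity : (0 < m)%N ->
  tensor_representation (identity_tensor R m.+1 n) = 1%:M.
Proof.
move=> m0; apply/matrixP => i j; rewrite !mxE.
rewrite big_mkcond (bigD1 (nseq_tuple m i)) //= big1 => [|s si].
  by rewrite addr0 ffunE constant_consE eqxx mem_nseq m0 eq_sym /=; case: eqP.
by rewrite ffunE constant_consE (negbTE si); case: ifP.
Qed.

End TensorApp.

(** * Comparison of a vector with a positive eigenvector *)

Section Comparison.
Variables (R : realType) (m n : nat).
Implicit Types (T : tensor R m.+1 n) (x y : 'rV[R]_n).

(** The number t is the largest quotient y_i / x_i. *)
Lemma tight_domination x y (i0 : 'I_n) : (forall i, 0 < x 0 i) ->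
  exists t i, (forall j, y 0 j <= t * x 0 j) /\ y 0 i = t * x 0 i.
Proof.
move=> x0; case: (@arg_maxP _ _ _ i0 xpredT (fun i => y 0 i / x 0 i)) => // i _ imax.
exists (y 0 i / x 0 i), i; split=> [j|]; last by rewrite divfK ?gt_eqF.
by rewrite -ler_pdivrMr //; apply: imax.
Qed.

(** Scale x to t x >= y with equality at a coordinate i.  Then
    mu y_i^m <= (T y)_i <= t^m (T x)_i <= lam (t x_i)^m = lam y_i^m, where
    y_i > 0. *)
Lemma collatz_wielandt_le T (lam mu : R) x y : nonneg_tensor T ->
  (forall i, 0 < x 0 i) -> (forall i, tensor_app T x i <= lam * x 0 i ^+ m) ->
  (forall i, 0 <= y 0 i) -> y != 0 ->
  (forall i, mu * y 0 i ^+ m <= tensor_app T y i) -> mu <= lam.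
Proof.
move=> T0 x0 Tx y0 /matrix0Pn[j0 [i0]]; rewrite ord1 => yi0 Ty.
have [t [i [ytx yi]]] := tight_domination y i0 x0.
have t0 : 0 < t.
  rewrite -(pmulr_lgt0 _ (x0 i0)); apply: lt_le_trans (ytx i0).
  by rewrite lt_def yi0 y0.
have yi_gt0 : 0 < y 0 i ^+ m by rewrite yi exprn_gt0 // mulr_gt0.
rewrite -(ler_pM2r yi_gt0); apply: le_trans (Ty i) _.
apply: (@le_trans _ _ (tensor_app T (t *: x) i)).
  by apply: ler_tensor_app => // j; rewrite y0 mxE ytx.
rewrite tensor_appZ yi exprMn mulrCA ler_pM2l //; exact: exprn_gt0.
Qed.

(** Let t x >= y be a tight domination.  If equality did not hold everywhere,
    an edge of G would lead from a coordinate of equality to a strict one, and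
    the two eigenvector equations would contradict strict monotonicity. *)
Lemma weakly_irreducible_eigenvector_unique T (lam : R) x y :
  nonneg_tensor T -> weakly_irreducible T ->
  (forall i, 0 < x 0 i) -> (forall i, tensor_app T x i = lam * x 0 i ^+ m) ->
  (forall i, 0 < y 0 i) -> (forall i, tensor_app T y i = lam * y 0 i ^+ m) ->
  \sum_i x 0 i = 1 -> \sum_i y 0 i = 1 -> y = x.
Proof.
move=> T0 Tirr x0 Tx y0 Ty sx sy.
have i0 : 'I_n.
  move: sx; case: (pickP (xpredT : pred 'I_n)) => [//|no].
  by rewrite big_pred0 // => /eqP; rewrite eq_sym oner_eq0.
have [t [i [ytx yi]]] := tight_domination y i0 x0.
pose I := [set j | y 0 j == t * x 0 j].
have [/eqP IT|IT] := boolP (I == finset.setT).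
  have ytxE : y = t *: x.
    by apply/rowP => j; move/setP/(_ j): IT; rewrite !inE mxE => /eqP.
  have t1 : t = 1.
    rewrite -sy -[LHS]mulr1 -[X in _ * X]sx mulr_sumr.
    by apply: eq_bigr => j _; rewrite ytxE mxE.
  by rewrite ytxE t1 scale1r.
have [|j [k [jI kI Tjk]]] := irreducible_exit Tirr _ IT.
  by apply/set0Pn; exists i; rewrite inE yi.
rewrite !inE in jI kI.
have : tensor_app T y j < tensor_app T (t *: x) j.
  apply: (ltr_tensor_app (j := k)) => // [l|]; first by rewrite y0 mxE ytx.
  by rewrite mxE lt_neqAle kI ytx.
by rewrite tensor_appZ Ty Tx (eqP jI) exprMn mulrCA ltxx.
Qed.

End Comparison.

(** * Complex eigenpairs of real tensors *)

Section ComplexEigenpairs.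
Variables (R : realType) (m n : nat).
Implicit Types (T : tensor R m.+1 n).

Lemma tensor_app_complexify T (x : 'rV[R]_n) i :
  tensor_app (complexify_tensor T) (complexify_vector x) i =
  (tensor_app T x i)%:C%C.
Proof.
rewrite /tensor_app rmorph_sum; apply: eq_bigr => s _.
rewrite rmorphM rmorph_prod ffunE; congr (_ * _).
by apply: eq_bigr => j _; rewrite mxE.
Qed.

Lemma eigenpair_complexify T (lam : R) (x : 'rV[R]_n) :
  eigenpair T lam%:C%C (complexify_vector x) <->
  x != 0 /\ forall i, tensor_app T x i = lam * x 0 i ^+ m.
Proof.
rewrite /eigenpair map_mx_eq0.
split=> -[x0 Tx]; split=> // i; last first.
  by rewrite tensor_app_complexify Tx mxE rmorphM rmorphXn.
apply: (@complexI R); rewrite -tensor_app_complexify Tx mxE.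
by rewrite rmorphM rmorphXn.
Qed.

Lemma complex_gt0_real (z : R[i]) : 0 < z -> z = (complex.Re z)%:C%C.
Proof. by case: z => a b; rewrite ltcE /= => /andP[/eqP ->]. Qed.

Lemma positive_eigenpair_real T (mu : R[i]) (y : 'rV[R[i]]_n) :
  positive_eigenpair T mu y ->
  exists (a : R) (z : 'rV[R]_n), [/\ mu = a%:C%C, y = complexify_vector z,
    0 < a, forall i, 0 < z 0 i & forall i, tensor_app T z i = a * z 0 i ^+ m].
Proof.
case=> Ty mu0 y0; exists (complex.Re mu), (map_mx (fun z => complex.Re z) y).
have muE := complex_gt0_real mu0.
have yE : y = complexify_vector (map_mx (fun z => complex.Re z) y).
  by apply/rowP => i; rewrite !mxE; apply: complex_gt0_real.
split=> //.
- by move: mu0; rewrite {1}muE ltcR.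
- by move=> i; move: (y0 i); rewrite (complex_gt0_real (y0 i)) ltcR mxE.
- by move: Ty; rewrite {1}muE {1}yE => /eigenpair_complexify[].
Qed.

Lemma sum_complexify (x : 'rV[R]_n) :
  \sum_i complexify_vector x 0 i = (\sum_i x 0 i)%:C%C.
Proof. by rewrite rmorph_sum; apply: eq_bigr => i _; rewrite mxE. Qed.

(** The triangle inequality for the vector of moduli: this is how complex
    eigenpairs become accessible to real comparison arguments. *)
Lemma eigenpair_modulus T mu y : nonneg_tensor T -> eigenpair T mu y ->
  exists z : 'rV[R]_n, [/\ z != 0, forall i, 0 <= z 0 i &
    forall i, Normc.normc mu * z 0 i ^+ m <= tensor_app T z i].
Proof.
move=> T0 [y0 Ty]; exists (map_mx (@Normc.normc R) y); split.
- apply: contra_neq y0 => /rowP yz; apply/rowP => i.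
  by have := yz i; rewrite !mxE => /Normc.eq0_normc.
- by move=> i; rewrite mxE; case: (y 0 i) => a b; rewrite sqrtr_ge0.
move=> i; rewrite -lecR -tensor_app_complexify rmorphM rmorphXn mxE.
have -> : (Normc.normc mu)%:C%C * (Normc.normc (y 0 i))%:C%C ^+ m
   = `|mu * y 0 i ^+ m| by rewrite normrM normrX.
rewrite -Ty; apply: le_trans (ler_norm_sum _ _ _) _.
apply: ler_sum => s _; rewrite normrM normr_prod ffunE.
rewrite ger0_norm ?lecR //; apply: ler_wpM2l; first by rewrite lecR.
by rewrite le_eqVlt; apply/orP; left; apply/eqP; apply: eq_bigr => j _; rewrite !mxE.
Qed.

Lemma spectral_radius_eq T (lam : R) (x : 'rV[R]_n) :
  0 <= lam -> x != 0 -> (forall i, tensor_app T x i = lam * x 0 i ^+ m) ->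
  (forall mu, tensor_eigenvalue T mu -> Normc.normc mu <= lam) ->
  is_maximum (eigenvalue_moduli T) lam /\ spectral_radius T = lam.
Proof.
move=> lam0 x0 Tx ub.
have Tlam : eigenvalue_moduli T lam.
  exists lam%:C%C; last by rewrite /= expr0n /= addr0 sqrtr_sqr ger0_norm.
  by exists (complexify_vector x); apply/eigenpair_complexify.
have ubT : ubound (eigenvalue_moduli T) lam by move=> _ [mu Tmu <-]; apply: ub.
split; first by split=> // y; apply: ubT.
apply/eqP; rewrite eq_le; apply/andP; split.
  by apply: ge_sup => //; exists lam.
by apply: ub_le_sup => //; exists lam.
Qed.

End ComplexEigenpairs.

(** * Limits of row vectors *)

Section RowVectorLimits.
Variables (R : realType) (n : nat).
Local Open Scope classical_set_scope.

Lemma cvg_row (U : Type) (F : set_system U) (FF : Filter F)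
    (f : U -> 'rV[R]_n) (l : 'rV[R]_n) :
  (forall i, f x 0 i @[x --> F] --> l 0 i) -> f x @[x --> F] --> l.
Proof.
move=> fl; apply/cvg_ballP => e e0.
have : \forall x \near F, forall i, ball (l 0 i) e (f x 0 i).
  by apply: filter_forall => i; move/cvg_ballP: (fl i); apply.
by apply: filterS => x fx; split=> // i j; rewrite !ord1.
Qed.

(** A continuous function takes at a cluster point the value of its limit along
    the sequence.  This replaces the extraction of a convergent subsequence. *)
Lemma cluster_eq_lim (u : nat -> 'rV[R]_n) (z : 'rV[R]_n)
    (g : 'rV[R]_n -> R) (l : R) :
  cluster (u k @[k --> \oo]) z -> {for z, continuous g} ->
  g (u k) @[k --> \oo] --> l -> g z = l.
Proof.
move=> uz gz gl; apply: norm_hausdorff => A B nA nB.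
have FB : (u k @[k --> \oo]) (g @^-1` B) by exact: gl.
have [x [/= Bx Ax]] := uz _ _ FB (gz _ nA).
by exists (g x).
Qed.

Lemma box_compact (a b : R) :
  compact [set x : 'rV[R]_n | forall i, x ord0 i \in `[a, b]%R].
Proof.
apply: (@rV_compact _ _ (fun=> `[a, b]%classic)) => _.
exact: segment_compact.
Qed.

Lemma cluster_box (u : nat -> 'rV[R]_n) (a b : R) :
  (\forall k \near \oo, forall i, a <= u k 0 i <= b) ->
  (exists z, cluster (u k @[k --> \oo]) z) /\
  (forall z, cluster (u k @[k --> \oo]) z -> forall i, a <= z 0 i <= b).
Proof.
move=> uab; pose K := [set x : 'rV[R]_n | forall i, x ord0 i \in `[a, b]%R].
have FK : (u k @[k --> \oo]) K.
  by apply: filterS uab => k uk i; rewrite in_itv /= uk.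
split; first by have [z [_ zc]] := @box_compact a b _ _ FK; exists z.
move=> z; rewrite clusterE => /(_ K FK).
have /closure_id <- : closed K.
  by apply: compact_closed; [exact: norm_hausdorff|exact: box_compact].
by move=> Kz i; have := Kz i; rewrite in_itv.
Qed.

Lemma cvg_of_cluster (u : nat -> 'rV[R]_n) (x : 'rV[R]_n) (a b : R) :
  (\forall k \near \oo, forall i, a <= u k 0 i <= b) ->
  (forall z, cluster (u k @[k --> \oo]) z -> z = x) ->
  u k @[k --> \oo] --> x.
Proof.
move=> uab ux; have [[z zc] zab] := cluster_box uab.
have zx := ux z zc; rewrite zx in zc.
(* The box is enlarged so that the limit lies in its interior. *)
pose K := [set y : 'rV[R]_n | forall i, y ord0 i \in `[a - 1, b + 1]%R].
apply: (@compact_cluster_set1 _ x _ K); first exact: norm_hausdorff.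
- exact: box_compact.
- apply/nbhs_ballP; exists 1 => //= y [_ xy] i.
  have /andP[ax xb] := zab _ zc i; move: (xy 0 i).
  rewrite /ball /= ltr_norml in_itv /= => /andP[y1 y2].
  by apply/andP; split; lra.
- apply: filterS uab => k uk i; rewrite in_itv /=.
  by have /andP[y1 y2] := uk i; apply/andP; split; lra.
- by apply/seteqP; split=> [y /ux|_ ->].
Qed.

End RowVectorLimits.

Section IteratedLimits.
Variables (R : realType) (U : topologicalType) (a : U) (I : Type) (r : seq I).
Implicit Types (f : I -> U -> R).
Local Open Scope classical_set_scope.

Lemma big_continuous_at (op : R -> R -> R) (c : R) f :
  continuous (fun x : R * R => op x.1 x.2) ->
  (forall i, {for a, continuous (f i)}) ->
  {for a, continuous (fun x => \big[op/c]_(i <- r) f i x)}.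
Proof.
move=> opc fc; apply: (@cvg_big R I op c xpredT opc U (nbhs a) r f (f^~ a)).
by move=> i _; exact: fc.
Qed.

End IteratedLimits.

(** * Continuity of the data of the power method *)

Section Continuity.
Variables (R : realType) (m n : nat).
Implicit Types (S : tensor R m.+1 n) (x : 'rV[R]_n).
Local Open Scope classical_set_scope.

Lemma tensor_app_continuous S i : continuous (fun x => tensor_app S x i).
Proof.
move=> x; apply: big_continuous_at => [|s]; first exact: add_continuous.
apply: (@cvgM _ _ (nbhs x)); first exact: cvg_cst.
apply: big_continuous_at => [|j]; first exact: mul_continuous.
exact: coord_continuous.
Qed.

Lemma power_ratio_continuous S i x :
  0 < x 0 i -> {for x, continuous (fun y => power_ratio S y i)}.
Proof.
move=> x0; apply: (@cvgM _ _ (nbhs x)); first exact: tensor_app_continuous.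
apply: (@cvgV _ _ (nbhs x)); first by rewrite expf_neq0 // gt_eqF.
apply: (@cvg_comp _ _ _ (fun y : 'rV[R]_n => y 0 i) (fun t => t ^+ m)).
  exact: coord_continuous.
exact: exprn_continuous.
Qed.

Lemma powR_gt0_continuous (p a : R) :
  0 < a -> {for a, continuous (fun t => t `^ p)}.
Proof.
move=> a0; apply: differentiable_continuous; apply/derivable1_diffP.
by apply: derivable_powR; rewrite in_itv /= a0.
Qed.

Lemma power_step_continuous S x : (0 < n)%N ->
  (forall i, 0 < tensor_app S x i) -> {for x, continuous (power_step S)}.
Proof.
move=> n0 Sx; have y0 i : 0 < tensor_app S x i `^ (m%:R)^-1 by rewrite powR_gt0.
have cvgy i : tensor_app S y i `^ (m%:R)^-1 @[y --> x] -->
    tensor_app S x i `^ (m%:R)^-1.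
  apply: (@cvg_comp _ _ _ (fun y => tensor_app S y i) (fun t => t `^ (m%:R)^-1)).
    exact: tensor_app_continuous.
  exact: powR_gt0_continuous.
apply: (@cvg_row _ _ _ (nbhs x) _) => i.
have E y : power_step S y 0 i = (\sum_j tensor_app S y j `^ (m%:R)^-1)^-1 *
    tensor_app S y i `^ (m%:R)^-1.
  by rewrite !mxE; congr (_^-1 * _); apply: eq_bigr => j _; rewrite mxE.
rewrite E; under eq_cvg do rewrite E.
apply: (@cvgM _ _ (nbhs x)); last exact: cvgy.
apply: (@cvgV _ _ (nbhs x)); last first.
  by apply: big_continuous_at => [|j]; [exact: add_continuous|exact: cvgy].
rewrite gt_eqF // (bigD1 (Ordinal n0)) //= ltr_pwDl //.
by apply: sumr_ge0 => j _; apply: ltW.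
Qed.

Lemma power_upper_continuous S x : (forall i, 0 < x 0 i) ->
  {for x, continuous (power_upper S)}.
Proof.
move=> x0; apply: big_continuous_at => [[a b]|i]; last exact: power_ratio_continuous.
by apply: continuous_max; [exact: cvg_fst|exact: cvg_snd].
Qed.

End Continuity.

(** * A priori bound *)

Section AprioriBound.
Variables (R : realType) (m n : nat) (T : tensor R m.+1 n).
Hypotheses (m0 : (0 < m)%N) (n0 : (0 < n)%N).
Hypotheses (T0 : nonneg_tensor T) (Tirr : weakly_irreducible T).

Lemma nonzero_entries_bounded_below :
  exists2 c : R, 0 < c & forall s, T s != 0 -> c <= T s.
Proof.
exists (\big[Num.min/1]_(s | T s != 0) T s) => [|s Ts].
  by apply/bigmin_gtP; split=> // s Ts; rewrite lt_def Ts T0.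
exact: bigmin_le_cond.
Qed.

(** Let x_p be the smallest coordinate and c a lower bound of the nonzero
    entries.  An edge from i to j gives c x_j x_p^(m-1) <= (T x)_i <= A x_i^m,
    so a bound x_i <= B x_p entails x_j <= (A / c) B^m x_p.  By irreducibility
    this reaches every coordinate after n steps, and the normalization turns the
    upper bound of all quotients x_j / x_p into a lower bound of x_p. *)
Lemma apriori_lower_bound (A : R) : exists2 d : R, 0 < d &
  forall x : 'rV[R]_n, (forall i, 0 < x 0 i) -> \sum_i x 0 i = 1 ->
    (forall i, tensor_app T x i <= A * x 0 i ^+ m) -> forall i, d <= x 0 i.
Proof.
have [c c0 cT] := nonzero_entries_bounded_below.
pose C := Num.max 1 (A / c).
have C1 : 1 <= C by rewrite le_max lexx.
have AC : A <= c * C by rewrite mulrC -ler_pdivrMr // le_max lexx orbT.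
(* The quotients x_j / x_p reached after k propagation steps are at most B k;
   C >= 1 makes B nondecreasing. *)
pose B := fix B k := if k is k'.+1 then C * B k' ^+ m else 1 : R.
have B1 k : 1 <= B k by elim: k => //= k IHk; rewrite mulr_ege1 // exprn_ege1.
have B0 k : 0 < B k by apply: lt_le_trans (B1 k).
have BS k : B k <= B k.+1.
  apply: (@le_trans _ _ (B k ^+ m)); first by rewrite ler_eXnr.
  by rewrite /= ler_peMl // exprn_ge0 // ltW.
exists (n%:R * B n)^-1 => [|x x0 sx Tx].
  by rewrite invr_gt0 mulr_gt0 // ltr0n.
case: (@arg_minP _ _ _ (Ordinal n0) xpredT (fun i => x 0 i)) => // p _ xmin.
have {}xmin j : x 0 p <= x 0 j by apply: xmin.
pose I k := [set j | x 0 j <= B k * x 0 p].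
have IT : I n = finset.setT.
  apply: chain_exhausts => [|k|k IkT].
  - by apply/set0Pn; exists p; rewrite inE mul1r.
  - apply/fintype.subsetP => j; rewrite !inE => /le_trans; apply.
    by rewrite ler_pM2r.
  have [|i [j [iI jI Tij]]] := irreducible_exit Tirr _ IkT.
    by apply/set0Pn; exists p; rewrite inE ler_peMl // ltW.
  exists j => //; rewrite inE.
  have [s js Ts] := tensor_representation_neq0 Tij.
  have xpm : x 0 p ^+ m = x 0 p * x 0 p ^+ m.-1 by rewrite -exprS prednK.
  have rest : x 0 p ^+ m.-1 <= \prod_(k <- rem j s) x 0 k.
    have -> : x 0 p ^+ m.-1 = \prod_(k <- rem j s) x 0 p.
      by rewrite big_const_seq count_predT size_rem // size_tuple iter_mulr_1.
    by apply: prod_seq_le => l; rewrite xmin ltW.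
  have low : c * (x 0 j * x 0 p ^+ m.-1) <= tensor_app T x i.
    rewrite /tensor_app (bigD1 s) //= (big_rem _ js) /=.
    rewrite -[leLHS]addr0 lerD //; last first.
      apply: sumr_ge0 => t _; apply: mulr_ge0 => //.
      by apply: prodr_ge0 => l _; apply: ltW.
    apply: ler_pM (cT _ Ts) _; [exact: ltW| |].
      by rewrite mulr_ge0 ?exprn_ge0 // ltW.
    by rewrite ler_pM2l.
  rewrite inE in iI.
  have : c * (x 0 j * x 0 p ^+ m.-1) <= c * (C * (B k * x 0 p) ^+ m).
    apply: le_trans low _; apply: le_trans (Tx i) _.
    rewrite mulrA; apply: ler_pM => //.
    - have := tensor_app_ge0 i T0 (fun j => ltW (x0 j)).
      by move/le_trans/(_ (Tx i)); rewrite pmulr_lge0 // exprn_gt0.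
    - by rewrite exprn_ge0 // ltW.
    - by rewrite lerXn2r // nnegrE ltW // mulr_gt0.
  by rewrite ler_pM2l // exprMn xpm !mulrA ler_pM2r // exprn_gt0.
have ub j : x 0 j <= B n * x 0 p by have : j \in I n; [rewrite IT finset.in_setT|rewrite inE].
move=> i; apply: le_trans (xmin i).
rewrite -[leLHS]mulr1 ler_pdivrMl ?mulr_gt0 ?ltr0n // -[leLHS]sx.
apply: le_trans (ler_sum _ (fun j _ => ub j)) _.
by rewrite sumr_const card_ord -[leLHS]mulr_natl mulrA.
Qed.

End AprioriBound.

(** * The power method for a shifted tensor *)

Section PowerMethod.
Variables (R : realType) (m n : nat) (T : tensor R m.+1 n).
Hypotheses (m0 : (0 < m)%N) (n0 : (0 < n)%N).
Hypotheses (T0 : nonneg_tensor T) (Tirr : weakly_irreducible T).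
Local Notation S := (T + identity_tensor R m.+1 n).
Implicit Types (x y z : 'rV[R]_n).

Lemma shifted_tensor_ge0 : nonneg_tensor S.
Proof. by apply: nonneg_tensorD => //; apply: identity_tensor_ge0. Qed.

Lemma tensor_app_shifted x i : tensor_app S x i = tensor_app T x i + x 0 i ^+ m.
Proof. by rewrite tensor_appD tensor_app_identity. Qed.

Lemma shifted_representation i j :
  tensor_representation S i j = tensor_representation T i j + (i == j)%:R.
Proof. by rewrite tensor_representationD tensor_representation_identity // !mxE. Qed.

Lemma weakly_irreducible_shifted : weakly_irreducible S.
Proof.
move=> [I [I0 IT SI]]; apply: Tirr; exists I; split=> // i j iI jI.
have := SI i j iI jI; rewrite shifted_representation.
by case: eqP => [ij|_]; [rewrite -ij iI in jI|rewrite addr0].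
Qed.

Lemma weakly_primitive_shifted : weakly_primitive S.
Proof.
apply: nonneg_irreducible_primitive => //.
- exact: tensor_representation_ge0 shifted_tensor_ge0.
- exact: weakly_irreducible_shifted.
- move=> i; rewrite shifted_representation eqxx ltr_wpDl //.
  exact: tensor_representation_ge0.
Qed.

Lemma tensor_app_shifted_gt0 x i : (forall j, 0 < x 0 j) -> 0 < tensor_app S x i.
Proof.
move=> x0; rewrite tensor_app_shifted ltr_wpDl ?exprn_gt0 //.
by apply: tensor_app_ge0 => // j; apply: ltW.
Qed.

(** Up to the positive factor c, the step is the m-th root of S x; every
    comparison of iterates below rests on this form. *)
Lemma power_stepP x : (forall i, 0 < x 0 i) ->
  [/\ forall i, 0 < power_step S x 0 i, \sum_i power_step S x 0 i = 1 &
   exists2 c : R, 0 < c &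
     forall i, power_step S x 0 i ^+ m = c * tensor_app S x i].
Proof.
move=> x0; pose y i := tensor_app S x i `^ (m%:R)^-1.
have Sx i := tensor_app_shifted_gt0 i x0.
have y0 i : 0 < y i by rewrite powR_gt0.
have E i : power_step S x 0 i = (\sum_j y j)^-1 * y i.
  by rewrite !mxE; congr (_^-1 * _); apply: eq_bigr => j _; rewrite mxE.
have s0 : 0 < \sum_j y j.
  rewrite (bigD1 (Ordinal n0)) //= ltr_pwDl //.
  by apply: sumr_ge0 => j _; apply: ltW.
split=> [i||]; first by rewrite E mulr_gt0 // invr_gt0.
  by rewrite (eq_bigr _ (fun i _ => E i)) -mulr_sumr mulVf // gt_eqF.
exists ((\sum_j y j)^-1 ^+ m) => [|i]; first by rewrite exprn_gt0 // invr_gt0.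
rewrite E exprMn; congr (_ * _).
rewrite -powR_mulrn ?powR_ge0 // -powRrM mulVf ?powRr1 //; first exact: ltW.
by rewrite pnatr_eq0 -lt0n.
Qed.

Lemma power_iterate_gt0 x k : (forall i, 0 < x 0 i) ->
  forall i, 0 < power_iterate S x k 0 i.
Proof. by move=> x0; elim: k => //= k /power_stepP[]. Qed.

Lemma power_upper_leP x (A : R) : (forall i, 0 < x 0 i) -> 0 <= A ->
  reflect (forall i, tensor_app S x i <= A * x 0 i ^+ m) (power_upper S x <= A).
Proof.
move=> x0 A0; apply: (iffP (bigmax_leP _ _ _ _)) => [[_ H] i|H].
  by rewrite -ler_pdivrMr ?exprn_gt0 //; apply: H.
by split=> // i _; rewrite ler_pdivrMr ?exprn_gt0.
Qed.

Lemma power_upper_ltP x (A : R) : (forall i, 0 < x 0 i) -> 0 < A ->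
  (forall i, tensor_app S x i < A * x 0 i ^+ m) -> power_upper S x < A.
Proof.
move=> x0 A0 H; apply/bigmax_ltP.
by split=> // i _; rewrite ltr_pdivrMr ?exprn_gt0.
Qed.

Lemma power_upper_ge1 x : (forall i, 0 < x 0 i) -> 1 <= power_upper S x.
Proof.
move=> x0; pose i := Ordinal n0; apply: le_trans (le_bigmax _ _ i).
rewrite ler_pdivlMr ?exprn_gt0 // mul1r tensor_app_shifted lerDr.
by apply: tensor_app_ge0 => // j; apply: ltW.
Qed.

Lemma power_upperP x i : (forall i, 0 < x 0 i) ->
  tensor_app S x i <= power_upper S x * x 0 i ^+ m.
Proof.
move=> x0; have A0 := le_trans ler01 (power_upper_ge1 x0).
by move: i; apply/power_upper_leP.
Qed.

(** With b^m = c A, the bound S x <= A x^m reads y <= b x for the next iterate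
    y, and the inequalities for y follow by applying S to it. *)
Lemma power_step_upper x (A : R) : (forall i, 0 < x 0 i) -> 0 < A ->
  (forall i, tensor_app S x i <= A * x 0 i ^+ m) ->
  let y := power_step S x in
  (forall i, tensor_app S y i <= A * y 0 i ^+ m) /\
  (forall i j, tensor_representation S i j != 0 ->
     tensor_app S x j < A * x 0 j ^+ m -> tensor_app S y i < A * y 0 i ^+ m).
Proof.
move=> x0 A0 Sx y; have [] := power_stepP x0; rewrite -/y => y0 _ [c c0 yE].
clearbody y.
pose b := (c * A) `^ (m%:R)^-1.
have bm : b ^+ m = c * A.
  rewrite -powR_mulrn ?powR_ge0 // -powRrM mulVf ?powRr1 //.
    by rewrite mulr_ge0 // ltW.
  by rewrite pnatr_eq0 -lt0n.
have b0 : 0 < b by rewrite powR_gt0 // mulr_gt0.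
have Sb i : tensor_app S (b *: x) i = A * y 0 i ^+ m.
  by rewrite tensor_appZ bm yE mulrAC mulrA mulrC mulrA.
have yb i : y 0 i <= (b *: x) 0 i.
  rewrite mxE -(ler_pXn2r m0) ?nnegrE; [|exact: ltW|exact/ltW/mulr_gt0].
  by rewrite yE exprMn bm -mulrA ler_pM2l.
split=> [i|i j Sij Sxj]; rewrite -Sb.
  by apply: ler_tensor_app shifted_tensor_ge0 _ => j; rewrite yb ltW.
apply: (ltr_tensor_app (j := j)) Sij; first exact: shifted_tensor_ge0.
  by move=> k; rewrite yb y0.
rewrite mxE -(ltr_pXn2r m0) ?nnegrE; [|exact: ltW|exact/ltW/mulr_gt0].
by rewrite yE exprMn bm -mulrA ltr_pM2l.
Qed.

Lemma power_iterate_upper x (A : R) k : (forall i, 0 < x 0 i) -> 0 < A ->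
  (forall i, tensor_app S x i <= A * x 0 i ^+ m) ->
  let y := power_iterate S x k in
  forall i, tensor_app S y i <= A * y 0 i ^+ m.
Proof.
move=> x0 A0 Sx; elim: k => [|k IHk] //=.
by have [] := power_step_upper (power_iterate_gt0 k x0) A0 IHk.
Qed.

(** The strict coordinates persist because S has a positive diagonal, and an
    edge of G from a nonstrict to a strict coordinate makes the former
    strict. *)
Lemma power_iterate_strict x (A : R) j : (forall i, 0 < x 0 i) -> 0 < A ->
  (forall i, tensor_app S x i <= A * x 0 i ^+ m) ->
  tensor_app S x j < A * x 0 j ^+ m -> power_upper S (power_iterate S x n) < A.
Proof.
move=> x0 A0 Sx Sxj; pose u k := power_iterate S x k.
have u0 k : forall i, 0 < u k 0 i := power_iterate_gt0 k x0.
have Su k := power_iterate_upper k x0 A0 Sx.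
have step k i l : tensor_representation S i l != 0 ->
    tensor_app S (u k) l < A * u k 0 l ^+ m ->
    tensor_app S (u k.+1) i < A * u k.+1 0 i ^+ m.
  by have [_] := power_step_upper (u0 k) A0 (Su k); apply.
have Tge0 := tensor_representation_ge0 T0.
have Sii i : tensor_representation S i i != 0.
  by rewrite shifted_representation eqxx gt_eqF // ltr_wpDl.
pose J k := [set i | tensor_app S (u k) i < A * u k 0 i ^+ m].
have jJ k : j \in J k.
  by elim: k => [|k]; rewrite !inE // => /(step _ _ _ (Sii j)).
suff JT : J n = finset.setT.
  apply: power_upper_ltP => // i.
  by have : i \in J n; [rewrite JT finset.in_setT|rewrite inE].
apply: chain_exhausts => [|k|k JkT].
- by apply/set0Pn; exists j.
- by apply/fintype.subsetP => i; rewrite !inE => /(step _ _ _ (Sii i)).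
have [| |i [l [iJ lJ Til]]] := irreducible_exit (I := ~: J k) Tirr.
- apply: contra_neq JkT => /(congr1 (@finset.setC _)).
  by rewrite finset.setCK finset.setC0.
- apply/eqP => /setP/(_ j); rewrite finset.in_setC finset.in_setT.
  by rewrite jJ.
exists i; first by rewrite inE in iJ.
rewrite !inE negbK in lJ; rewrite inE; apply: step lJ.
rewrite shifted_representation gt_eqF // ltr_pwDl // lt_def.
by rewrite Til Tge0.
Qed.

Lemma constant_upper_eigenvector z (A : R) : (forall i, 0 < z 0 i) -> 0 < A ->
  (forall k, power_upper S (power_iterate S z k) = A) ->
  forall i, tensor_app S z i = A * z 0 i ^+ m.
Proof.
move=> z0 A0 Az i; apply/eqP.
have Sz j : tensor_app S z j <= A * z 0 j ^+ m.
  by rewrite -(Az 0%N); apply: power_upperP.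
have := Sz i; rewrite le_eqVlt => /orP[//|/(power_iterate_strict z0 A0 Sz)].
by rewrite Az ltxx.
Qed.

Local Open Scope classical_set_scope.

Lemma power_iterate_continuous z k : (forall i, 0 < z 0 i) ->
  {for z, continuous (fun x => power_iterate S x k)}.
Proof.
move=> z0; elim: k => [|k IHk]; first exact: cvg_id.
apply: (@cvg_comp _ _ _ (fun x => power_iterate S x k) (power_step S)) IHk _.
apply: power_step_continuous => // i.
exact/tensor_app_shifted_gt0/power_iterate_gt0.
Qed.

Lemma power_iterate_bounded x : (forall i, 0 < x 0 i) ->
  exists2 d : R, 0 < d &
    \forall k \near \oo, forall i, d <= power_iterate S x k 0 i <= 1.
Proof.
move=> x0; have A0 := lt_le_trans ltr01 (power_upper_ge1 x0).
have [d d0 dP] := apriori_lower_bound m0 n0 T0 Tirr (power_upper S x).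
(* The starting vector is not normalized, so the bounds hold from rank 1 on. *)
exists d => //; exists 1%N => // -[//|k] _ i.
have u0 := power_iterate_gt0 k x0.
have [v0 sv _] := power_stepP u0.
have Sv := power_iterate_upper k.+1 x0 A0 (fun i => power_upperP i x0).
apply/andP; split.
  apply: dP => // j; apply: le_trans (Sv j).
  by rewrite tensor_app_shifted lerDl exprn_ge0 // ltW // power_iterate_gt0.
rewrite -sv (bigD1 i) //= lerDl; apply: sumr_ge0 => j _; exact: ltW.
Qed.

(** The upper ratio of the k-th iterate is a continuous function of the starting
    vector; along the sequence it tends to the limit A of the upper ratios,
    whatever k is, so it equals A at a cluster point for all k. *)
Lemma power_iterate_cluster x : (forall i, 0 < x 0 i) -> exists A : R,
  forall z, cluster (power_iterate S x k @[k --> \oo]) z ->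
  [/\ forall i, 0 < z 0 i, \sum_i z 0 i = 1 &
      forall i, tensor_app S z i = A * z 0 i ^+ m].
Proof.
move=> x0; pose u k := power_iterate S x k.
have u0 k : forall i, 0 < u k 0 i := power_iterate_gt0 k x0.
pose al k := power_upper S (u k).
have al1 k : 1 <= al k by apply: power_upper_ge1.
have aldec : nonincreasing_seq al.
  apply/nonincreasing_seqP => k.
  have al0 := lt_le_trans ltr01 (al1 k).
  apply/power_upper_leP; [exact: u0|exact: ltW|].
  by have [] := power_step_upper (u0 k) al0 (fun i => power_upperP i (u0 k)).
have /cvg_ex[A alA] : cvgn al.
  apply: nonincreasing_is_cvgn => //; exists 1 => _ [k _ <-] //.
have A0 : 0 < A.
  apply: (@lt_le_trans _ _ 1) => //; rewrite -(cvg_lim _ alA) //.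
  apply: limr_ge; first by apply/cvg_ex; exists A.
  by near=> k; apply: al1.
exists A => z zc; have [d d0 ud] := power_iterate_bounded x0.
have z0 i : 0 < z 0 i.
  have [_ /(_ z zc i) /andP[dz _]] := cluster_box ud.
  exact: lt_le_trans dz.
split=> //.
  apply: (cluster_eq_lim (g := fun y : 'rV[R]_n => \sum_i y 0 i) zc).
    apply: big_continuous_at => [|i]; first exact: add_continuous.
    exact: coord_continuous.
  apply: cvg_near_cst; exists 1%N => // -[//|k] _ /=.
  by have [] := power_stepP (u0 k).
apply: constant_upper_eigenvector => // k.
apply: (cluster_eq_lim (g := fun y => power_upper S (power_iterate S y k)) zc).
  apply: (@cvg_comp _ _ _ (fun y => power_iterate S y k) (power_upper S)).
    exact: power_iterate_continuous.
  exact/power_upper_continuous/power_iterate_gt0.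
rewrite (_ : (fun l => _) = (fun l => al (l + k)%N)); last first.
  by apply/funext => l; rewrite /al /u /power_iterate addnC iterD.
by rewrite cvg_shiftn.
Unshelve. all: by end_near. Qed.

Lemma power_ratios_converge (u : nat -> 'rV[R]_n) x (A : R) : 0 <= A ->
  (forall i, 0 < x 0 i) ->
  (forall i, tensor_app S x i = A * x 0 i ^+ m) -> u k @[k --> \oo] --> x ->
  (power_upper S (u k) @[k --> \oo] --> A) /\
  (power_lower S (u k) @[k --> \oo] --> A).
Proof.
move=> A0 x0 Sx ux.
have Ax i : power_ratio S x i = A.
  by rewrite /power_ratio Sx mulfK // expf_neq0 // gt_eqF.
have near_ratio e : 0 < e ->
    \forall k \near \oo, forall i, `|A - power_ratio S (u k) i| < e.
  move=> e0; apply: filter_forall => i.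
  have : power_ratio S (u k) i @[k --> \oo] --> power_ratio S x i.
    apply: (@cvg_comp _ _ _ u (fun y => power_ratio S y i)) ux _.
    exact: power_ratio_continuous.
  by rewrite Ax => /cvgrPdist_lt; apply.
have near_bounds e : 0 < e ->
    \forall k \near \oo, `|A - power_upper S (u k)| <= e /\
                         `|A - power_lower S (u k)| <= e.
  move=> /near_ratio; apply: filterS => k ue; pose i := Ordinal n0.
  have {}ue j : A - e < power_ratio S (u k) j < A + e.
    by rewrite -ltr_distl distrC.
  have e0 : 0 < e by have /andP[h1 h2] := ue i; lra.
  have up : A - e <= power_upper S (u k) <= A + e.
    apply/andP; split.
      apply: le_trans (le_bigmax _ _ i).
      by have /andP[/ltW] := ue i.
    apply/bigmax_leP; split=> [|j _]; first by rewrite addr_ge0 // ltW.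
    by have /andP[_ /ltW] := ue j.
  have lo : A - e <= power_lower S (u k) <= A + e.
    apply/andP; split.
      apply/bigmin_geP; split=> [|j _]; first by have /andP[] := up.
      by have /andP[/ltW] := ue j.
    apply: (@le_trans _ _ (power_ratio S (u k) i)); first exact: bigmin_le.
    by have /andP[_ /ltW] := ue i.
  by rewrite ![`|A - _|]distrC !ler_distl.
by split; apply/cvgrPdist_le => e /near_bounds; apply: filterS => k [].
Qed.

(** Any starting point provides the eigenvector x.  For another one, a cluster
    point of its iterates is a positive eigenvector for some B; comparing it
    with x in both directions gives B = A, so it is x by uniqueness. *)
Theorem shifted_power_method : exists (A : R) x,
  [/\ 1 <= A, forall i, 0 < x 0 i, \sum_i x 0 i = 1,
      forall i, tensor_app S x i = A * x 0 i ^+ m &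
      power_method_converges S A x].
Proof.
pose e : 'rV[R]_n := const_mx 1.
have e0 i : 0 < e 0 i by rewrite mxE.
have [A Ae] := power_iterate_cluster e0.
have [x xc] : exists x, cluster (power_iterate S e k @[k --> \oo]) x.
  by have [d _ /cluster_box[]] := power_iterate_bounded e0.
have [x0 sx Sx] := Ae x xc.
have A1 : 1 <= A.
  rewrite -(ler_pM2r (exprn_gt0 m (x0 (Ordinal n0)))) -Sx mul1r.
  rewrite tensor_app_shifted lerDr; apply: tensor_app_ge0 => // j; exact: ltW.
exists A, x; split=> // y y0.
have A0 := le_trans ler01 A1.
have TE z B : (forall i, tensor_app S z i = B * z 0 i ^+ m) ->
    forall i, tensor_app T z i = (B - 1) * z 0 i ^+ m.
  by move=> Sz i; rewrite mulrBl -Sz tensor_app_shifted mul1r addrK.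
have nz z : (forall i, 0 < z 0 i) -> z != 0.
  by move=> z0; apply/eqP => /rowP/(_ (Ordinal n0)); rewrite mxE => /eqP;
     rewrite gt_eqF.
have ge0 z : (forall i, 0 < z 0 i) -> forall i, 0 <= z 0 i.
  by move=> z0 i; apply: ltW.
have yx : power_iterate S y k @[k --> \oo] --> x.
  have [d _ yd] := power_iterate_bounded y0.
  apply: (cvg_of_cluster yd) => z zc.
  have [B /(_ z zc) [z0 sz Sz]] := power_iterate_cluster y0.
  have BA : B = A.
    apply/eqP; rewrite eq_le; apply/andP; split.
      apply: (collatz_wielandt_le shifted_tensor_ge0 x0 _ (ge0 _ z0) (nz _ z0)).
        by move=> i; rewrite Sx.
      by move=> i; rewrite Sz.
    apply: (collatz_wielandt_le shifted_tensor_ge0 z0 _ (ge0 _ x0) (nz _ x0)).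
      by move=> i; rewrite Sz.
    by move=> i; rewrite Sx.
  rewrite BA in Sz.
  exact: (weakly_irreducible_eigenvector_unique T0 Tirr x0 (TE _ _ Sx) z0
    (TE _ _ Sz)).
by have [] := power_ratios_converge A0 x0 Sx yx.
Qed.

End PowerMethod.

(** * Spectral radius of a nonnegative tensor *)

Section Perron.
Variables (R : realType) (m n : nat).
Hypotheses (m0 : (0 < m)%N) (n0 : (0 < n)%N).
Implicit Types (T : tensor R m.+1 n) (x y : 'rV[R]_n).

Lemma sum1_neq0 x : \sum_i x 0 i = 1 -> x != 0.
Proof.
move=> sx; apply/eqP => x0; move: sx; rewrite x0 big1 => [/eqP|i _].
  by rewrite eq_sym oner_eq0.
by rewrite mxE.
Qed.

Lemma weakly_irreducible_perron T : nonneg_tensor T -> weakly_irreducible T ->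
  exists (lam : R) x, [/\ 0 <= lam, forall i, 0 < x 0 i, \sum_i x 0 i = 1,
    forall i, tensor_app T x i = lam * x 0 i ^+ m &
    power_method_converges (T + identity_tensor R m.+1 n) (lam + 1) x].
Proof.
move=> T0 Tirr; have [A [x [A1 x0 sx Sx cx]]] := shifted_power_method m0 n0 T0 Tirr.
exists (A - 1), x; split=> // [|i|]; rewrite ?subr_ge0 ?subrK //.
by rewrite mulrBl -Sx tensor_app_shifted mul1r addrK.
Qed.

Lemma positive_eigenvector_spectral_radius T (lam : R) x : nonneg_tensor T ->
  (forall i, 0 < x 0 i) -> (forall i, tensor_app T x i = lam * x 0 i ^+ m) ->
  is_maximum (eigenvalue_moduli T) lam /\ spectral_radius T = lam.
Proof.
move=> T0 x0 Tx; pose i0 := Ordinal n0.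
apply: (spectral_radius_eq (x := x)) => //.
- have := tensor_app_ge0 i0 T0 (fun j => ltW (x0 j)).
  by rewrite Tx pmulr_lge0 // exprn_gt0.
- by apply/eqP => /rowP/(_ i0)/eqP; rewrite mxE gt_eqF.
move=> mu [y /(eigenpair_modulus T0) [z [nz z0 Tz]]].
by apply: (collatz_wielandt_le T0 x0 _ z0 nz Tz) => i; rewrite Tx.
Qed.

Lemma weakly_irreducible_unique_positive T (lam : R) x : nonneg_tensor T ->
  weakly_irreducible T -> 0 < lam -> (forall i, 0 < x 0 i) ->
  \sum_i x 0 i = 1 -> (forall i, tensor_app T x i = lam * x 0 i ^+ m) ->
  unique_positive_eigenpair T lam%:C%C (complexify_vector x).
Proof.
move=> T0 Tirr lam0 x0 sx Tx; split.
- split; first by apply/eigenpair_complexify; split=> //; apply: sum1_neq0.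
    by rewrite ltcR.
  by move=> i; rewrite mxE ltcR.
- by rewrite sum_complexify sx.
move=> mu y /positive_eigenpair_real [a [z [-> -> a0 z0 Tz]]].
rewrite sum_complexify => /(@complexI R) sz.
have [_ rx] := positive_eigenvector_spectral_radius T0 x0 Tx.
have [_ rz] := positive_eigenvector_spectral_radius T0 z0 Tz.
rewrite -rz rx in Tz *; split=> //; congr complexify_vector.
exact: (weakly_irreducible_eigenvector_unique T0 Tirr x0 Tx z0 Tz).
Qed.

Lemma weakly_irreducible_eigenvalue_gt0 T (lam : R) x : (1 < n)%N ->
  nonneg_tensor T -> weakly_irreducible T -> (forall i, 0 < x 0 i) ->
  (forall i, tensor_app T x i = lam * x 0 i ^+ m) -> 0 < lam.
Proof.
move=> n1 T0 Tirr x0 Tx; pose i0 := Ordinal n0.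
(* A tensor of dimension 1 may vanish; n > 1 forces a nonzero entry in the
   row of i0, by irreducibility. *)
have [| |i [j [iI jI Tij]]] := irreducible_exit (I := [set i0]) Tirr.
- by apply/set0Pn; exists i0; rewrite inE.
- apply/eqP => /(congr1 (fun A : {set 'I_n} => #|A|)).
  by rewrite cards1 cardsT card_ord => n1E; rewrite -n1E in n1.
have [s js Ts] := tensor_representation_neq0 Tij.
rewrite -(pmulr_lgt0 _ (exprn_gt0 m (x0 i))) -Tx /tensor_app (bigD1 s) //=.
rewrite ltr_pwDl //; last first.
  by apply: sumr_ge0 => t _; rewrite mulr_ge0 // prodr_ge0 // => k _; apply: ltW.
by rewrite mulr_gt0 ?prodr_gt0 // lt_def Ts T0.
Qed.

Local Open Scope classical_set_scope.

Lemma constant_tensor_irreducible (c : R) T : 0 < c -> nonneg_tensor T ->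
  weakly_irreducible (T + [ffun=> c]).
Proof.
move=> c0 T0 [I [/set0Pn[i iI] IT /(_ i)]].
have [j jI] : exists j, j \notin I.
  apply: contrapT => nj; move/eqP: IT; apply; apply/setP => j.
  by rewrite finset.in_setT; apply: contrapT => /negP jI; apply: nj; exists j.
move=> /(_ j iI jI) /eqP; apply/negP.
apply: (@tensor_representation_gt0 _ _ _ _ _ _ (nseq_tuple m j)).
- by move=> s; rewrite !ffunE addr_ge0 // ltW.
- by rewrite mem_nseq m0 eqxx.
- by rewrite !ffunE gt_eqF // ltr_wpDl.
Qed.

(** The eigenvalues l k of T plus the constant tensor 1 / (k + 1) decrease, as
    each is a Collatz-Wielandt bound for the next; the limit inherits this bound
    for T, and a cluster point of the eigenvectors is an eigenvector for the
    limit because the equation of T is violated by at most a multiple of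
    1 / (k + 1) plus l k - lam. *)
Theorem nonneg_perron T : nonneg_tensor T -> exists (lam : R) x,
  [/\ 0 <= lam, x != 0, forall i, 0 <= x 0 i,
      forall i, tensor_app T x i = lam * x 0 i ^+ m &
      forall mu y, (forall i, 0 <= y 0 i) -> y != 0 ->
        (forall i, mu * y 0 i ^+ m <= tensor_app T y i) -> mu <= lam].
Proof.
move=> T0; pose J : tensor R m.+1 n := [ffun=> 1].
pose Te k : tensor R m.+1 n := T + [ffun=> @harmonic R k].
have h0 k : 0 < @harmonic R k by rewrite /harmonic invr_gt0 ltr0n.
have Te0 k : nonneg_tensor (Te k).
  by move=> s; rewrite !ffunE addr_ge0 // ltW.
have J0 : nonneg_tensor J by move=> s; rewrite ffunE.
have appTe k y i :
    tensor_app (Te k) y i = tensor_app T y i + @harmonic R k * tensor_app J y i.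
  rewrite tensor_appD /tensor_app mulr_sumr; congr (_ + _).
  by apply: eq_bigr => s _; rewrite !ffunE mul1r.
have /choice [p pP] : forall k, exists p : R * 'rV[R]_n, [/\ 0 <= p.1,
    forall i, 0 < p.2 0 i, \sum_i p.2 0 i = 1 &
    forall i, tensor_app (Te k) p.2 i = p.1 * p.2 0 i ^+ m].
  move=> k; have [lam [x [l0 x0 sx Tx _]]] :=
    weakly_irreducible_perron (Te0 k) (constant_tensor_irreducible (h0 k) T0).
  by exists (lam, x).
pose l k := (p k).1; pose u k := (p k).2.
have l0 k : 0 <= l k by have [] := pP k.
have u0 k i : 0 < u k 0 i by have [_ + _ _] := pP k; apply.
have su k : \sum_i u k 0 i = 1 by have [] := pP k.
have Tu k i : tensor_app (Te k) (u k) i = l k * u k 0 i ^+ m by have [] := pP k.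
have u01 k i : 0 <= u k 0 i <= 1.
  rewrite ltW //= -(su k) (bigD1 i) //= lerDl.
  by apply: sumr_ge0 => j _; apply: ltW.
have bound k mu y : (forall i, 0 <= y 0 i) -> y != 0 ->
    (forall i, mu * y 0 i ^+ m <= tensor_app (Te k) y i) -> mu <= l k.
  by apply: (collatz_wielandt_le (Te0 k) (u0 k)) => i; rewrite Tu.
have ldec : nonincreasing_seq l.
  apply/nonincreasing_seqP => k; apply: (bound k _ (u k.+1)) => [i||i].
  - exact: ltW.
  - exact: sum1_neq0.
  rewrite -Tu !appTe lerD2l; apply: ler_wpM2r.
    by apply: tensor_app_ge0 => // j; apply: ltW.
  by rewrite /harmonic lef_pV2 ?posrE ?ltr0n // ler_nat.
have lc : cvgn l by apply: nonincreasing_is_cvgn => //; exists 0 => _ [k _ <-].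
pose lam : R := lim (l @ \oo).
have llam k : lam <= l k by apply: nonincreasing_cvgn_ge.
have ubox : \forall k \near \oo, forall i, 0 <= u k 0 i <= 1.
  by apply: nearW => k; apply: u01.
have [[z zc] zbox] := cluster_box ubox.
have z0 i : 0 <= z 0 i by have /andP[] := zbox z zc i.
have sz : \sum_i z 0 i = 1.
  apply: (cluster_eq_lim (g := fun y : 'rV[R]_n => \sum_i y 0 i) zc).
    apply: big_continuous_at => [|i]; first exact: add_continuous.
    exact: coord_continuous.
  by apply: cvg_near_cst; apply: nearW.
exists lam, z; split=> //.
- by apply: limr_ge => //; apply: nearW.
- exact: sum1_neq0.
- move=> i; apply/eqP; rewrite -subr_eq0; apply/eqP.
  pose N : R := tensor_app J (const_mx 1) i.
  apply: (cluster_eq_lim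
    (g := fun y : 'rV[R]_n => tensor_app T y i - lam * y 0 i ^+ m) zc).
    apply: (@cvgB _ _ _ (nbhs z)); first exact: tensor_app_continuous.
    apply: (@cvgM _ _ (nbhs z)); first exact: cvg_cst.
    apply: (@cvg_comp _ _ _ (fun y : 'rV[R]_n => y 0 i) (fun t => t ^+ m)).
      exact: coord_continuous.
    exact: exprn_continuous.
  have uE k : tensor_app T (u k) i - lam * u k 0 i ^+ m =
      (l k - lam) * u k 0 i ^+ m - @harmonic R k * tensor_app J (u k) i.
    have := Tu k i; rewrite appTe mulrBl => <-.
    by rewrite addrAC addrK.
  have hJ k : 0 <= @harmonic R k * tensor_app J (u k) i <= @harmonic R k * N.
    rewrite mulr_ge0 ?(ltW (h0 k)) //=.
      apply: ler_wpM2l; first exact: ltW.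
      by apply: ler_tensor_app => // j; rewrite mxE.
    by apply: tensor_app_ge0 => // j; apply: ltW.
  (* The coordinates of u k lie in [0, 1], so the perturbation term lies
     between 0 and N / (k + 1). *)
  apply: (@squeeze_cvgr _ _ _ _ (fun k => - (@harmonic R k * N)) (fun k => l k - lam)).
  + apply: nearW => k; rewrite uE.
    have /andP[h1 h2] := hJ k; have /andP[u1 u2] := u01 k i.
    have um1 : u k 0 i ^+ m <= 1 by rewrite exprn_ile1.
    have um0 : 0 <= u k 0 i ^+ m by rewrite exprn_ge0.
    have lk := llam k.
    apply/andP; split; nra.
  + rewrite -[X in _ --> X]oppr0 -[X in _ --> - X](mul0r N); apply: cvgN.
    by apply: cvgM; [exact: cvg_harmonic|exact: cvg_cst].
  + rewrite -[X in _ --> X](subrr lam); apply: cvgB => //; exact: cvg_cst.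
move=> mu y y0 ny Ty; apply: limr_ge => //; apply: nearW => k.
apply: (bound k mu y) => // i; apply: le_trans (Ty i) _.
by rewrite appTe lerDl mulr_ge0 ?(ltW (h0 k)) // tensor_app_ge0.
Qed.

Lemma nonneg_spectral_radius T : nonneg_tensor T ->
  is_maximum (eigenvalue_moduli T) (spectral_radius T) /\
  forall mu y, (forall i, 0 <= y 0 i) -> y != 0 ->
    (forall i, mu * y 0 i ^+ m <= tensor_app T y i) -> mu <= spectral_radius T.
Proof.
move=> T0; have [lam [x [lam0 nx x0 Tx ub]]] := nonneg_perron T0.
have [|maxl ->] := spectral_radius_eq lam0 nx Tx; last by [].
by move=> mu [y /(eigenpair_modulus T0) [z [nz z0]]]; apply: ub.
Qed.

Lemma spectral_radius_ge0 T : nonneg_tensor T -> 0 <= spectral_radius T.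
Proof.
move=> /nonneg_spectral_radius[[[mu _ <-] _] _].
by case: mu => a b; rewrite sqrtr_ge0.
Qed.

Lemma block_eigenpair_exists T : nonneg_tensor T -> weakly_irreducible T ->
  exists x, block_eigenpair T (spectral_radius T) x.
Proof.
move=> T0 Tirr; have [lam [x [lam0 x0 sx Tx _]]] := weakly_irreducible_perron T0 Tirr.
have [_ ->] := positive_eigenvector_spectral_radius T0 x0 Tx.
exists x; rewrite /block_eigenpair; case: eqP => [n1|n1]; last first.
  apply: weakly_irreducible_unique_positive => //.
  apply: weakly_irreducible_eigenvalue_gt0 T0 Tirr x0 Tx.
  by rewrite ltn_neqAle eq_sym n0 andbT; apply/eqP.
have all0 (i : 'I_n) : i = 0%N :> nat.
  by apply/eqP; rewrite -leqn0 -ltnS -n1.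
have all_eq (i j : 'I_n) : i = j by apply: val_inj; rewrite /= !all0.
have xE : x = const_mx 1.
  apply/rowP => i; rewrite mxE -sx (bigD1 i) //= big1 ?addr0 // => j.
  by rewrite (all_eq j i) eqxx.
split=> //; last by apply/eigenpair_complexify; split=> //; apply: sum1_neq0.
move=> s; have := Tx (thead s); rewrite xE mxE expr1n mulr1 => <-.
rewrite /tensor_app (bigD1 (behead_tuple s)) //= [X in _ + X]big1 => [|t].
  rewrite addr0 big1 => [|j _]; last by rewrite mxE.
  rewrite mulr1; congr (T _); apply/eq_from_tnth => j; exact: all_eq.
by case/eqP; apply/eq_from_tnth => j; apply: all_eq.
Qed.

End Perron.

(** * Restriction of a tensor along an injection of index sets *)

(** An induced tensor is the pullback along the enumeration of the index set.
    Allowing every injection f makes nested induced tensors composites, which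
    avoids comparing enumerations. *)
Definition pullback_tensor (K : Type) d a b (f : 'I_a -> 'I_b)
    (T : tensor K d b) : tensor K d a :=
  [ffun s : d.-tuple 'I_a => T (map_tuple f s)].

Section Pullback.
Variables (a b : nat) (f : 'I_a -> 'I_b).
Hypothesis f_inj : injective f.

Lemma sum_map_tuple (K : nmodType) m (F : m.-tuple 'I_b -> K) :
  (forall s : m.-tuple 'I_b, ~~ all [in codom f] s -> F s = 0) ->
  \sum_s F s = \sum_t F (map_tuple f t).
Proof.
move=> F0; rewrite (bigID [in [set map_tuple f t | t : m.-tuple 'I_a]]) /=.
rewrite [X in _ + X]big1 ?addr0 => [|s sf].
  rewrite big_imset /=; first by apply: eq_bigl => t.
  by move=> t u _ _ /(congr1 val) /= /(inj_map f_inj) /val_inj.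
apply: F0; apply: contra sf => /allP sf; apply/imsetP.
have sz : size (preim_seq f s) == m.
  by rewrite -(size_map f) map_preim // size_tuple.
by exists (Tuple sz) => //; apply: val_inj; rewrite /= map_preim.
Qed.

Lemma pullback_tensor_cons (K : Type) m (T : tensor K m.+1 b) i
    (t : m.-tuple 'I_a) :
  pullback_tensor f T [tuple of i :: t] = T [tuple of f i :: map_tuple f t].
Proof. by rewrite ffunE; congr (T _); apply: val_inj. Qed.

(** The hypothesis covers the two reasons for which a monomial leaving the image
    of f can vanish: its coefficient is zero, or a coordinate of x is. *)
Lemma tensor_app_pullback (K : comPzRingType) m (T : tensor K m.+1 b)
    (x : 'rV[K]_b) i :
  (forall s : m.-tuple 'I_b, ~~ all [in codom f] s ->
     T [tuple of f i :: s] * \prod_(j <- s) x 0 j = 0) ->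
  tensor_app (pullback_tensor f T) (colsub f x) i = tensor_app T x (f i).
Proof.
move=> T0; rewrite [RHS]/tensor_app sum_map_tuple //; apply: eq_bigr => t _.
rewrite pullback_tensor_cons /= big_map; congr (_ * _).
by apply: eq_bigr => j _; rewrite mxE.
Qed.

Lemma extend_by_zero (K : nmodType) (z : 'rV[K]_a) : exists x : 'rV[K]_b,
  colsub f x = z /\ forall j, j \notin codom f -> x 0 j = 0.
Proof.
exists (\row_j if [pick i | f i == j] is Some i then z 0 i else 0).
split=> [|j jf]; [apply/rowP => i|]; rewrite !mxE; case: pickP => [k /eqP|] //.
- by move/f_inj ->.
- by move/(_ i); rewrite eqxx.
- by move=> fk; move/negP: jf; case; rewrite -fk codom_f.
Qed.

Lemma complexify_pullback (R : rcfType) d (T : tensor R d b) :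
  complexify_tensor (pullback_tensor f T) =
  pullback_tensor f (complexify_tensor T).
Proof. by apply/ffunP => s; rewrite !ffunE. Qed.

Lemma pullback_tensor_ge0 (R : realType) d (T : tensor R d b) :
  nonneg_tensor T -> nonneg_tensor (pullback_tensor f T).
Proof. by move=> T0 s; rewrite ffunE. Qed.

Lemma pullback_symmetric (K : Type) d (T : tensor K d b) :
  symmetric_tensor T -> symmetric_tensor (pullback_tensor f T).
Proof. by move=> Tsym s t st; rewrite !ffunE; apply/Tsym/perm_map. Qed.

Hypothesis f_surj : forall j, j \in codom f.

Lemma weakly_irreducible_pullback (K : pzRingType) m (T : tensor K m.+1 b) :
  weakly_irreducible T -> weakly_irreducible (pullback_tensor f T).
Proof.
have GE i j : tensor_representation (pullback_tensor f T) i j =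
    tensor_representation T (f i) (f j).
  rewrite !mxE [RHS]big_mkcond [RHS]sum_map_tuple => [|s]; last first.
    by case/negP; apply/allP => k _ /=; apply: f_surj.
  rewrite big_mkcond; apply: eq_bigr => t _.
  by rewrite pullback_tensor_cons /= mem_map.
move=> Tirr [I [I0 IT TI]]; apply: Tirr; exists (f @: I); split.
- by have /set0Pn[i iI] := I0; apply/set0Pn; exists (f i); apply: imset_f.
- apply: contra_neq IT => fI; apply/setP => i; rewrite finset.in_setT.
  by rewrite -(mem_imset _ _ f_inj) fI finset.in_setT.
move=> _ j /imsetP[i iI ->]; have /codomP[k ->] := f_surj j.
by rewrite mem_imset // => kI; rewrite -GE TI.
Qed.

Lemma tensor_eigenvalue_pullback (R : rcfType) m (T : tensor R m.+1 b) lam :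
  tensor_eigenvalue T lam -> tensor_eigenvalue (pullback_tensor f T) lam.
Proof.
move=> [x [x0 Tx]]; exists (colsub f x); split.
  apply: contra_neq x0 => /rowP fx0; apply/rowP => j; rewrite mxE.
  by have /codomP[i ->] := f_surj j; have := fx0 i; rewrite !mxE.
move=> i; rewrite complexify_pullback tensor_app_pullback ?Tx ?mxE // => s.
by case/negP; apply/allP => k _ /=; apply: f_surj.
Qed.

End Pullback.

(** The image in 'I_n of a set of indices of an induced tensor has its own
    enumeration besides the composite of two enumerations; they differ by a
    bijection. *)
Lemma pullback_same_image (K : Type) d n a b (f : 'I_a -> 'I_n) (g : 'I_b -> 'I_n)
    (T : tensor K d n) :
  injective f -> injective g -> codom f =i codom g ->
  exists h : 'I_b -> 'I_a, [/\ injective h, forall j, j \in codom h &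
    pullback_tensor g T = pullback_tensor h (pullback_tensor f T)].
Proof.
move=> f_inj g_inj fg.
have gf i : g i \in codom f by rewrite fg codom_f.
have fh i : f (iinv (gf i)) = g i by apply: f_iinv.
exists (fun i => iinv (gf i)); split.
- by move=> i j /(congr1 f); rewrite !fh => /g_inj.
- move=> j; have : f j \in codom g by rewrite -fg codom_f.
  by move=> /codomP[i fj]; apply/codomP; exists i; apply: f_inj; rewrite fh.
apply/ffunP => s; rewrite !ffunE; congr (T _); apply: val_inj => /=.
by rewrite -map_comp; apply: eq_map => i /=; rewrite fh.
Qed.

Section SameImage.
Variables (n a b : nat) (f : 'I_a -> 'I_n) (g : 'I_b -> 'I_n).
Hypotheses (f_inj : injective f) (g_inj : injective g).
Hypothesis (fg : codom f =i codom g).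

Lemma weakly_irreducible_same_image (K : pzRingType) m (T : tensor K m.+1 n) :
  weakly_irreducible (pullback_tensor f T) ->
  weakly_irreducible (pullback_tensor g T).
Proof.
have [h [h_inj h_surj ->]] := pullback_same_image T f_inj g_inj fg.
exact: weakly_irreducible_pullback.
Qed.

Lemma tensor_eigenvalue_same_image (R : rcfType) m (T : tensor R m.+1 n) lam :
  tensor_eigenvalue (pullback_tensor f T) lam ->
  tensor_eigenvalue (pullback_tensor g T) lam.
Proof.
have [h [h_inj h_surj ->]] := pullback_same_image T f_inj g_inj fg.
exact: tensor_eigenvalue_pullback.
Qed.

End SameImage.

Lemma pullback_id (K : Type) d n (T : tensor K d n) : pullback_tensor id T = T.
Proof.
by apply/ffunP => s; rewrite ffunE; congr (T _); apply: val_inj; rewrite /= map_id.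
Qed.

Lemma pullback_comp (K : Type) d n a b (f : 'I_a -> 'I_n) (g : 'I_b -> 'I_a)
    (T : tensor K d n) :
  pullback_tensor g (pullback_tensor f T) = pullback_tensor (f \o g) T.
Proof.
apply/ffunP => s; rewrite !ffunE; congr (T _); apply: val_inj => /=.
by rewrite -map_comp.
Qed.

Lemma codom_enum_val n (I : {set 'I_n}) i :
  (i \in codom (enum_val (A := mem I))) = (i \in I).
Proof.
apply/codomP/idP => [[j ->]|iI]; first exact: enum_valP.
by exists (enum_rank_in iI i); rewrite enum_rankK_in.
Qed.

(** * Block triangular representations *)

Section Blocks.
Variables (R : realType) (m n : nat) (T : tensor R m.+1 n) (J : seq {set 'I_n}).
Hypothesis (T0 : nonneg_tensor T).
Hypothesis (TJ : block_triangular (tensor_representation T) J).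

Lemma block_of i : exists2 p, (p < size J)%N & i \in nth finset.set0 J p.
Proof.
have [_ /and3P[/eqP cJ _ _] _ _] := TJ.
have : i \in finset.cover [set B in J] by rewrite cJ finset.in_setT.
case/bigcupP => B; rewrite inE => BJ iB.
by exists (index B J); [rewrite index_mem|rewrite nth_index].
Qed.

Lemma block_neq0 B : B \in J -> (0 < #|B|)%N.
Proof.
have [_ /and3P[_ _ nJ] _ _] := TJ.
by rewrite card_gt0 => BJ; apply: contraNneq nJ => <-; rewrite inE.
Qed.

Lemma representation_eq0_entry i j (s : m.-tuple 'I_n) :
  tensor_representation T i j = 0 -> j \in val s -> T [tuple of i :: s] = 0.
Proof.
move=> /eqP Tij js; apply/eqP; apply: contraTT Tij.
exact: tensor_representation_gt0.
Qed.

Lemma block_triangular_entry p q i j (s : m.-tuple 'I_n) :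
  (q < p < size J)%N -> i \in nth finset.set0 J p -> j \in nth finset.set0 J q ->
  j \in val s -> T [tuple of i :: s] = 0.
Proof.
have [_ _ _ tri] := TJ; move=> qp ip jq.
exact/representation_eq0_entry/tri/jq/ip.
Qed.

(** In the last block on which x does not vanish, the entries pointing to
    earlier blocks are zero and x is zero on the later ones. *)
Lemma block_triangular_eigenvalue lam : tensor_eigenvalue T lam ->
  exists2 B, B \in J & tensor_eigenvalue (induced_tensor T B) lam.
Proof.
move=> [x [x0 Tx]].
pose Q p := (p < size J)%N &&
  [exists i, (i \in nth finset.set0 J p) && (x 0 i != 0)].
have exQ : exists p, Q p.
  have /matrix0Pn[i0 [k]] := x0; rewrite ord1 => xk.
  have [p pJ kp] := block_of k.
  by exists p; rewrite /Q pJ; apply/existsP; exists k; rewrite kp.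
have Qub p : Q p -> (p <= size J)%N by case/andP => /ltnW.
(* The last block on which x does not vanish. *)
case: (ex_maxnP exQ Qub) => p /andP[pJ /existsP[k /andP[kp xk]]] pmax.
pose B := nth finset.set0 J p.
exists B; first exact: mem_nth.
exists (colsub (enum_val (A := mem B)) x); split.
  apply: contra_neq xk => /rowP/(_ (enum_rank_in kp k)).
  by rewrite !mxE enum_rankK_in.
move=> i; rewrite complexify_pullback tensor_app_pullback ?Tx ?mxE //.
  exact: enum_val_inj.
move=> s /allPn[j js]; rewrite /= codom_enum_val => jB.
have [q qJ jq] := block_of j.
have [ltqp|ltpq|qp] := ltngtP q p.
- rewrite ffunE (@block_triangular_entry p q _ j) ?ltqp ?mul0r //.
  exact: enum_valP.
- rewrite (big_rem _ js) /= (_ : x 0 j = 0) ?mul0r ?mulr0 //.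
  apply/eqP; apply: contraTT ltpq => xj; rewrite -leqNgt; apply: pmax.
  by rewrite /Q qJ; apply/existsP; exists j; rewrite jq.
- by rewrite /B -qp jq in jB.
Qed.

(** A symmetric entry can be read with either of the indices i and j in front,
    hence with the one lying in the later block, where triangularity kills
    it. *)
Lemma symmetric_blocks_split B (s : m.+1.-tuple 'I_n) i j :
  symmetric_tensor T -> B \in J -> i \in s -> j \in s -> i \in B -> j \notin B ->
  T s = 0.
Proof.
move=> Tsym BJ si sj iB jB.
have front k l : k != l -> k \in s -> l \in s ->
    exists2 t : m.-tuple 'I_n, T s = T [tuple of k :: t] & l \in val t.
  move=> kl sk sl; have sz : size (rem k s) == m.
    by rewrite size_rem // size_tuple.
  exists (Tuple sz); first by apply: Tsym; apply: perm_to_rem.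
  have := perm_mem (perm_to_rem sk) l; rewrite sl inE eq_sym (negbTE kl).
  by move=> /= /esym.
have ij : i != j by apply: contraNneq jB => <-.
pose p := index B J; have pJ : (p < size J)%N by rewrite index_mem.
have ip : i \in nth finset.set0 J p by rewrite nth_index.
have [q qJ jq] := block_of j.
have [ltqp|ltpq|qp] := ltngtP q p.
- have [t -> jt] := front i j ij si sj.
  by apply: block_triangular_entry ip jq jt; rewrite ltqp.
- have [|t -> it] := front j i _ sj si; first by rewrite eq_sym.
  by apply: block_triangular_entry jq ip it; rewrite ltpq.
- by rewrite qp nth_index // (negbTE jB) in jq.
Qed.

End Blocks.

(** * The recursive partition *)

Lemma mem_bigcup_seq (I : Type) (T : finType) (r : seq I) (F : I -> {set T}) x :
  (x \in \bigcup_(B <- r) F B) = has (fun B => x \in F B) r.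
Proof.
by elim: r => [|B r IHr]; rewrite ?big_nil ?big_cons !inE //= IHr.
Qed.

Lemma refine_partition n (J : seq {set 'I_n})
    (Q : forall B : {set 'I_n}, {set {set 'I_#|B|}}) :
  finset.partition [set B in J] [set: 'I_n] ->
  (forall B, B \in J -> finset.partition (Q B) [set: 'I_#|B|]) ->
  finset.partition
    (\bigcup_(B <- J) [set enum_val (A := mem B) @: C | C : {set 'I_#|B|} in Q B])
    [set: 'I_n].
Proof.
move=> /and3P[/eqP cJ tJ nJ] Qpart.
have subB (B : {set 'I_n}) (C : {set 'I_#|B|}) i :
    i \in enum_val (A := mem B) @: C -> i \in B.
  by case/imsetP => j _ ->; apply: enum_valP.
apply/and3P; split.
- apply/eqP/setP => i; rewrite finset.in_setT.
  have : i \in finset.cover [set B in J] by rewrite cJ finset.in_setT.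
  case/bigcupP => B; rewrite inE => BJ iB.
  have /and3P[/eqP cB _ _] := Qpart B BJ.
  have : enum_rank_in iB i \in finset.cover (Q B) by rewrite cB finset.in_setT.
  case/bigcupP => C CQ iC; apply/bigcupP; exists (enum_val (A := mem B) @: C).
    by rewrite mem_bigcup_seq; apply/hasP; exists B => //; apply: imset_f.
  by rewrite -[X in X \in _](enum_rankK_in iB iB) imset_f.
- apply/finset.trivIsetP => X Y.
  rewrite !mem_bigcup_seq => /hasP[B BJ /imsetP[C CQ ->]].
  move=> /hasP[B' BJ' /imsetP[C' CQ' ->]] XY.
  have [BB|nBB] := eqVneq B B'; last first.
    have dis : [disjoint B & B'].
      by move/finset.trivIsetP: tJ; apply; rewrite ?inE.
    rewrite disjoint_subset; apply/fintype.subsetP => i /subB iB.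
    rewrite inE; apply/negP => /subB iB'.
    by move/disjointFr: dis => /(_ i iB); rewrite iB'.
  subst B'; have /and3P[_ /finset.trivIsetP tB _] := Qpart B BJ.
  have CC : C != C' by apply: contraNneq XY => ->.
  rewrite imset_disjoint; first exact: tB.
  exact: enum_val_inj.
- rewrite mem_bigcup_seq; apply/hasPn => B BJ.
  apply/imsetP => -[C CQ /esym/eqP]; rewrite imset_eq0 => /eqP C0.
  have /and3P[_ _] := Qpart B BJ.
  by rewrite -C0 CQ.
Qed.

Section WiPartition.
Variables (R : realType) (m : nat).

(** The procedure applied to an induced tensor returns sets of indices of that
    tensor; the inductive step transports each of the four properties to the
    images of these sets, which index the same entries in another order. *)
Lemma wi_partitionP n (T : tensor R m.+1 n) (P : {set {set 'I_n}}) :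
  wi_partition T P -> (0 < n)%N -> nonneg_tensor T ->
  [/\ finset.partition P [set: 'I_n],
      forall I, I \in P -> weakly_irreducible (induced_tensor T I),
      forall lam, tensor_eigenvalue T lam ->
        exists2 I, I \in P & tensor_eigenvalue (induced_tensor T I) lam &
      symmetric_tensor T -> forall I (s : m.+1.-tuple 'I_n) i j, I \in P ->
        i \in s -> j \in s -> i \in I -> j \notin I -> T s = 0].
Proof.
elim: n T P / => [n T Tirr|n T J Q Tred TJ _ IH] n0 T0.
  have ev_inj := @enum_val_inj _ (mem [set: 'I_n]).
  have ev_codom : codom id =i codom (enum_val (A := mem [set: 'I_n])).
    by move=> i; rewrite codom_enum_val finset.in_setT; apply: (codom_f id).
  rewrite -(pullback_id T) in Tirr.
  split.
  - rewrite /finset.partition finset.cover1 eqxx finset.trivIset1 finset.in_set1 eq_sym.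
    by apply/set0Pn; exists (Ordinal n0).
  - move=> I; rewrite finset.in_set1 => /eqP ->.
    exact: (weakly_irreducible_same_image (@inj_id _) ev_inj ev_codom Tirr).
  - move=> lam; rewrite -{1}(pullback_id T) => Tlam.
    exists [set: 'I_n]; first by rewrite finset.in_set1.
    exact: (tensor_eigenvalue_same_image (@inj_id _) ev_inj ev_codom Tlam).
  - by move=> _ I s i j; rewrite finset.in_set1 => /eqP ->; rewrite !finset.in_setT.
have ind0 B : nonneg_tensor (induced_tensor T B) by apply: pullback_tensor_ge0.
have {}IH B (BJ : B \in J) := IH B BJ (block_neq0 TJ BJ) (ind0 B).
have nested (B : {set 'I_n}) (C : {set 'I_#|B|}) :
    let g := enum_val (A := mem B) \o enum_val (A := mem C) in
    injective g /\
    codom g =i codom (enum_val (A := mem (enum_val (A := mem B) @: C))).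
  split=> [|i]; first by apply: inj_comp; apply: enum_val_inj.
  rewrite codom_enum_val; apply/codomP/imsetP => [[j ->]|[k kC ->]].
    by exists (enum_val j) => //; apply: enum_valP.
  by exists (enum_rank_in kC k); rewrite /= enum_rankK_in.
split.
- have [_ pJ _ _] := TJ; apply: refine_partition => // B BJ.
  by have [] := IH B BJ.
- move=> I; rewrite mem_bigcup_seq => /hasP[B BJ /imsetP[C CQ ->]].
  have [_ /(_ C CQ) irrC _ _] := IH B BJ; have [g_inj g_codom] := nested B C.
  apply: (weakly_irreducible_same_image g_inj (@enum_val_inj _ _) g_codom).
  by rewrite -pullback_comp.
- move=> lam /(block_triangular_eigenvalue T0 TJ) [B BJ].
  have [_ _ /(_ lam) + _] := IH B BJ => /[apply] -[C CQ evC].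
  have [g_inj g_codom] := nested B C.
  exists (enum_val (A := mem B) @: C).
    by rewrite mem_bigcup_seq; apply/hasP; exists B => //; apply: imset_f.
  apply: (tensor_eigenvalue_same_image g_inj (@enum_val_inj _ _) g_codom).
  by rewrite -pullback_comp.
move=> Tsym I s i j; rewrite mem_bigcup_seq => /hasP[B BJ /imsetP[C CQ ->]].
move=> si sj /imsetP[i' iC iE] jI.
have [sB|/allPn[k sk kB]] := boolP (all [in B] s); last first.
  by apply: (symmetric_blocks_split T0 TJ Tsym BJ si sk) kB; rewrite iE enum_valP.
have sf : {subset val s <= codom (enum_val (A := mem B))}.
  by move=> k sk; rewrite codom_enum_val; apply: (allP sB).
have sz : size (preim_seq (enum_val (A := mem B)) s) == m.+1.
  by rewrite -(size_map (enum_val (A := mem B))) map_preim // size_tuple.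
have sE : s = map_tuple (enum_val (A := mem B)) (Tuple sz).
  by apply: val_inj; rewrite /= map_preim.
have /codomP[j' jE] := sf j sj.
have jC : j' \notin C by apply: contra jI => jC; rewrite jE imset_f.
have [_ _ _ /(_ (pullback_symmetric _ Tsym))] := IH B BJ.
move=> /(_ C (Tuple sz) i' j' CQ) H.
have -> : T s = induced_tensor T B (Tuple sz) by rewrite ffunE -sE.
by apply: H => //; rewrite -(mem_map (@enum_val_inj _ (mem B))) -?iE -?jE;
   rewrite -[X in _ \in X]/(val (map_tuple _ (Tuple sz))) -sE.
Qed.

End WiPartition.

(** * The block eigenpairs and the spectral radius of the whole tensor *)

Section BlocksOfNonneg.
Variables (R : realType) (m n : nat) (T : tensor R m.+1 n).
Hypotheses (m0 : (0 < m)%N) (n0 : (0 < n)%N) (T0 : nonneg_tensor T).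

Lemma induced_tensor_ge0 (I : {set 'I_n}) : nonneg_tensor (induced_tensor T I).
Proof. exact: pullback_tensor_ge0. Qed.

Lemma prod_eq0_of_mem (x : 'rV[R]_n) (s : seq 'I_n) j :
  j \in s -> x 0 j = 0 -> \prod_(k <- s) x 0 k = 0.
Proof. by move=> js xj; rewrite (big_rem _ js) /= xj mul0r. Qed.

Lemma tensor_app_supported (I : {set 'I_n}) (x : 'rV[R]_n) i :
  (forall j, j \notin I -> x 0 j = 0) -> 
  tensor_app (induced_tensor T I) (subvector x I) i = tensor_app T x (enum_val i).
Proof.
move=> xI; apply: tensor_app_pullback => [|s /allPn[j js]].
  exact: enum_val_inj.
rewrite /= codom_enum_val => /xI xj.
by rewrite (prod_eq0_of_mem js xj) mulr0.
Qed.

(** A nonnegative eigenvector of the induced tensor, extended by zero, is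
    subinvariant for T, as T y >= 0 outside the block. *)
Lemma spectral_radius_induced_le (I : {set 'I_n}) : (0 < #|I|)%N ->
  spectral_radius (induced_tensor T I) <= spectral_radius T.
Proof.
move=> I0; have TI0 := @induced_tensor_ge0 I.
have [lam [z [lam0 nz z0 Tz ub]]] := nonneg_perron m0 I0 TI0.
have -> : spectral_radius (induced_tensor T I) = lam.
  have [|_ //] := spectral_radius_eq lam0 nz Tz.
  by move=> mu [y /(eigenpair_modulus TI0) [w [nw w0]]]; apply: ub.
have [x [xz x0]] := extend_by_zero (@enum_val_inj _ (mem I)) z.
have xI j : j \notin I -> x 0 j = 0 by rewrite -codom_enum_val; apply: x0.
have inI j (jI : j \in I) : x 0 j = z 0 (enum_rank_in jI j).
  by rewrite -xz mxE enum_rankK_in.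
have xge0 j : 0 <= x 0 j.
  by have [jI|/xI->//] := boolP (j \in I); rewrite (inI _ jI).
have [_ /(_ lam x xge0)] := nonneg_spectral_radius m0 n0 T0; apply.
  by apply: contra_neq nz => x_eq0; apply/rowP => i; rewrite -xz x_eq0 !mxE.
move=> j; have [jI|/xI->] := boolP (j \in I); last first.
  by rewrite expr0n gtn_eqF // mulr0 tensor_app_ge0.
have := Tz (enum_rank_in jI j).
by rewrite -xz tensor_app_supported // mxE enum_rankK_in // => <-.
Qed.

Lemma block_eigenpair_real a (S : tensor R m.+1 a) (lam : R) (x : 'rV[R]_a) :
  block_eigenpair S lam x ->
  [/\ x != 0, forall i, 0 <= x 0 i &
      forall i, tensor_app S x i = lam * x 0 i ^+ m].
Proof.
rewrite /block_eigenpair; case: eqP => _.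
  by case=> _ xE /eigenpair_complexify[nx Sx]; split=> // i; rewrite xE mxE.
case=> -[/eigenpair_complexify[nx Sx] _ x0] _ _; split=> // i.
by have := x0 i; rewrite mxE ltcR => /ltW.
Qed.

(** An eigenvalue of T of largest modulus is an eigenvalue of some block, and no
    block exceeds T. *)
Lemma spectral_radius_wi_partition (P : {set {set 'I_n}}) : wi_partition T P ->
  spectral_radius T = \big[Num.max/0]_(I in P) spectral_radius (induced_tensor T I).
Proof.
move=> TP; have [/and3P[_ _ P0] _ evP _] := wi_partitionP TP n0 T0.
have Igt0 I : I \in P -> (0 < #|I|)%N.
  by rewrite card_gt0 => IP; apply: contraNneq P0 => <-.
apply/eqP; rewrite eq_le; apply/andP; split; last first.
  apply/bigmax_leP; split; first exact: spectral_radius_ge0.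
  by move=> I /Igt0; apply: spectral_radius_induced_le.
have [[[mu /evP[I IP muI] <-] _] _] := nonneg_spectral_radius m0 n0 T0.
apply: le_trans (le_bigmax_cond _ _ IP).
have [[_ maxI] _] := nonneg_spectral_radius m0 (Igt0 I IP) (@induced_tensor_ge0 I).
by apply: maxI; exists mu.
Qed.

(** Outside the block, a monomial with nonzero value has all its variables in
    the block; there is at least one because m > 0, so its coefficient is
    zero. *)
Lemma supported_eigenvector (I : {set 'I_n}) (lam : R) (x : 'rV[R]_n) :
  (forall (s : m.+1.-tuple 'I_n) i j, i \in s -> j \in s -> i \in I ->
     j \notin I -> T s = 0) ->
  (forall i, i \notin I -> x 0 i = 0) ->
  (forall i, tensor_app (induced_tensor T I) (subvector x I) i =
     lam * subvector x I 0 i ^+ m) ->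
  forall i, tensor_app T x i = lam * x 0 i ^+ m.
Proof.
move=> TI xI Tx i; have [iI|iI] := boolP (i \in I).
  have := Tx (enum_rank_in iI i).
  by rewrite tensor_app_supported // mxE enum_rankK_in.
rewrite xI // expr0n gtn_eqF // mulr0; apply: big1 => s _.
have [/allP sI|/allPn[j js /xI xj]] := boolP (all [in I] s); last first.
  by rewrite (prod_eq0_of_mem js xj) mulr0.
have js : tnth s (Ordinal m0) \in s by apply: mem_tnth.
rewrite (TI _ (tnth s (Ordinal m0)) i) ?mul0r ?inE ?eqxx ?orbT //.
- by rewrite js orbT.
- exact: sI.
Qed.

End BlocksOfNonneg.

Theorem theorem5p4 (R : realType) (m n : nat) (hm : (1 <= m)%N) (hn : (2 <= n)%N)
    (T : tensor R m.+1 n) (T_ge0 : nonneg_tensor T) :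
  let E := identity_tensor R m.+1 n in
  (weakly_irreducible T ->
    weakly_primitive (T + E) /\
    exists x : 'rV[R]_n,
      [/\ unique_positive_eigenpair (T + E)
            (spectral_radius (T + E))%:C%C (complexify_vector x),
          power_method_converges (T + E) (spectral_radius (T + E)) x &
          unique_positive_eigenpair T
            (spectral_radius (T + E) - 1)%:C%C (complexify_vector x)])
  /\
  (~ weakly_irreducible T ->
    forall P : {set {set 'I_n}}, wi_partition T P ->
    [/\ [/\ finset.partition P [set: 'I_n], (1 < #|P|)%N &
            forall I, I \in P -> weakly_irreducible (induced_tensor T I)],
        forall I, I \in P ->
          exists x : 'rV[R]_#|I|,
            block_eigenpair (induced_tensor T I) (spectral_radius (induced_tensor T I)) x,
        is_maximum (eigenvalue_moduli T) (spectral_radius T) /\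
        spectral_radius T =
          \big[Num.max/0]_(I in P) spectral_radius (induced_tensor T I) &
        symmetric_tensor T ->
          forall I, I \in P ->
          (forall I', I' \in P ->
             spectral_radius (induced_tensor T I') <= spectral_radius (induced_tensor T I)) ->
          forall (xI : 'rV[R]_#|I|) (x : 'rV[R]_n),
            block_eigenpair (induced_tensor T I) (spectral_radius (induced_tensor T I)) xI ->
            subvector x I = xI ->
            (forall i, i \notin I -> x 0 i = 0) ->
            (forall i, 0 <= x 0 i) /\ tensor_eigenvector T (complexify_vector x)]).
Proof.
move=> E; have m0 : (0 < m)%N := hm; have n0 : (0 < n)%N := ltnW hn.
split=> [Tirr|Tred P TP].
  split; first exact: weakly_primitive_shifted.
  have [lam [x [_ x0 sx Tx cx]]] := weakly_irreducible_perron m0 n0 T_ge0 Tirr.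
  have lam0 := weakly_irreducible_eigenvalue_gt0 n0 hn T_ge0 Tirr x0 Tx.
  have S0 : nonneg_tensor (T + E) := shifted_tensor_ge0 T_ge0.
  have Sx i : tensor_app (T + E) x i = (lam + 1) * x 0 i ^+ m.
    by rewrite tensor_app_shifted Tx mulrDl mul1r.
  have [_ ->] := positive_eigenvector_spectral_radius n0 S0 x0 Sx.
  exists x; split=> //; last first.
    by rewrite addrK; apply: weakly_irreducible_unique_positive.
  apply: weakly_irreducible_unique_positive => //; last exact: addr_gt0.
  exact: weakly_irreducible_shifted.
have [partP irrP evP symP] := wi_partitionP TP n0 T_ge0.
have Igt0 I : I \in P -> (0 < #|I|)%N.
  have /and3P[_ _ P0] := partP.
  by rewrite card_gt0 => IP; apply: contraNneq P0 => <-.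
split.
- split=> //; rewrite ltnNge; apply/negP => P1; apply: Tred.
  have [I IP] : exists I, I \in P.
    have /and3P[/eqP cP _ _] := partP.
    have : Ordinal n0 \in finset.cover P by rewrite cP finset.in_setT.
    by case/bigcupP => I IP _; exists I.
  have IT : I = [set: 'I_n].
    have /and3P[/eqP cP _ _] := partP.
    have PE : P = [set I].
      by apply/esym/eqP; rewrite eqEcard finset.sub1set IP cards1.
    by rewrite -cP PE finset.cover1.
  have := irrP I IP; rewrite IT => irrT.
  rewrite -(pullback_id T).
  apply: (weakly_irreducible_same_image (@enum_val_inj _ _) (@inj_id _) _ irrT).
  by move=> i; rewrite codom_enum_val finset.in_setT; apply/esym/(codom_f id).
- move=> I IP; apply: block_eigenpair_exists (irrP I IP) => //.
    exact: Igt0.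
  exact: induced_tensor_ge0.
- split; last exact: spectral_radius_wi_partition.
  by have [] := nonneg_spectral_radius m0 n0 T_ge0.
move=> Tsym I IP _ xI x /block_eigenpair_real[nxI xI0 TxI] xE x0.
have xge0 i : 0 <= x 0 i.
  have [iI|/x0->//] := boolP (i \in I).
  have := xI0 (enum_rank_in iI i).
  by rewrite -xE mxE enum_rankK_in.
split=> //; exists (spectral_radius (induced_tensor T I))%:C%C.
apply/eigenpair_complexify; split.
  by apply: contra_neq nxI => x_eq0; apply/rowP => i; rewrite -xE x_eq0 !mxE.
rewrite -xE in TxI; apply: (supported_eigenvector m0) x0 TxI.
by move=> s i j; apply: symP.
Qed.
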